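(* Let $1<p\le q\le 2$, $0<\delta<1$, $c>0$, $R>0$, and let $h_1,h_2$ be continuous radial functions on $B_R=B_R(0)\subset\mathbb{R}^N$ such that $0\le h_1\le h_2$ but $h_1\not\equiv h_2$ in $B_R$. Assume that $u_1,u_2\in C^{1,\alpha}(\overline{B_R})$ are radially decreasing solutions of $$-\Delta_p u_1-\Delta_q u_1=\frac{c}{u_1^\delta}+h_1(x)\ \text{ in }B_R,\qquad u_1=0\ \text{ on }\partial B_R,$$ $$-\Delta_p u_2-\Delta_q u_2=\frac{c}{u_2^\delta}+h_2(x)\ \text{ in }B_R,\qquad u_2=0\ \text{ on }\partial B_R.$$ Then $0<u_1<u_2$ in $B_R$ and $\frac{\partial u_2}{\partial\nu}<\frac{\partial u_1}{\partial\nu}<0$ on $\partial B_R$.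
   Context: $B_R(0)=\{x\in\mathbb{R}^N:|x|<R\}$; $\Delta_s u=\operatorname{div}(|\nabla u|^{s-2}\nabla u)$ for $s=p,q$; $\nu$ is the outward unit normal on $\partial B_R$. Solutions are understood in the weak (distributional) sense. ''Radial'' means depending only on $|x|$, and ''radially decreasing'' means radial and decreasing in $|x|$. *)

(* Defs.v *)
From HB Require Import structures.
From mathcomp Require Import all_boot all_order all_algebra.
From mathcomp Require Import all_classical all_reals all_analysis.
Set Implicit Arguments.
Unset Strict Implicit.
Unset Printing Implicit Defensive.
Import Order.TTheory GRing.Theory Num.Theory.
Import numFieldNormedType.Exports.
Local Open Scope classical_set_scope.
Local Open Scope ring_scope.

(* Row vectors carry the product (= Borel) sigma-algebra, i.e., the one        *)
(* generated by the coordinate functions.                                      *)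
Section measurable_row.
Context {R : realType} {n : nat}.

Let coors (i : 'I_n) (x : 'rV[R]_n) : R := x 0 i.

Let row_set0 : g_sigma_preimage coors set0.
Proof. exact: sigma_algebra0. Qed.

Let row_setC A : g_sigma_preimage coors A -> g_sigma_preimage coors (~` A).
Proof. exact: sigma_algebraC. Qed.

Let row_bigcup (F : (set 'rV[R]_n)^nat) :
  (forall i, g_sigma_preimage coors (F i)) ->
  g_sigma_preimage coors (\bigcup_i (F i)).
Proof. exact: sigma_algebra_bigcup. Qed.

HB.instance Definition _ := @isMeasurable.Build default_measure_display
  'rV[R]_n (g_sigma_preimage coors) row_set0 row_setC row_bigcup.

End measurable_row.

Section measurable_row_theory.
Context {R : realType}.

Lemma measurable_coord n (i : 'I_n) :
  measurable_fun [set: 'rV[R]_n] (fun x => x 0 i : R).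
Proof.
move=> _ Y mY; rewrite setTI; apply: sub_sigma_algebra => /=.
rewrite -bigcup_seq/=; exists i => /=; first by rewrite mem_index_enum.
by exists Y => //; rewrite setTI.
Qed.

Lemma measurable_fun_rowP d (T : measurableType d) n (f : T -> 'rV[R]_n) :
  (forall i, measurable_fun [set: T] (fun x => f x 0 i : R)) ->
  measurable_fun [set: T] f.
Proof.
move=> mf.
have sub : g_sigma_preimage (fun i x => f x 0 i : R) `<=` measurable.
  apply: smallest_sub; first exact: sigma_algebra_measurable.
  case: n => [|n] in f mf *; first by rewrite big_ord0.
  rewrite -bigcup_mkord_ord; apply: bigcup_sub => i Ii.
  by move=> A [B mB <-]; exact: mf.
move=> _ A mA; apply: sub.
rewrite (@g_sigma_preimage_comp _ _ _ 'rV[R]_n (fun i x => x 0 i : R)).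
by exists A.
Qed.

Definition rV_cons n (p : measurableTypeR R * 'rV[R]_n) : 'rV[R]_n.+1 :=
  row_mx (p.1 : R)%:M p.2.

Let measurable_rV_cons n : measurable_fun setT (@rV_cons n).
Proof.
apply: measurable_fun_rowP => i; case: (@split_ordP 1 n i) => j ->.
  rewrite [X in measurable_fun _ X](_ : _ = fst); first exact: measurable_fst.
  by apply/funext => p; rewrite [LHS]row_mxEl !ord1 mxE eqxx mulr1n.
rewrite [X in measurable_fun _ X](_ : _ = (fun x : 'rV[R]_n => x 0 j) \o snd).
  exact: (measurableT_comp (measurable_coord j) measurable_snd).
by apply/funext => p; rewrite [LHS]row_mxEr.
Qed.

HB.instance Definition _ n := isMeasurableFun.Build _ _ _ _ (@rV_cons n)
  (@measurable_rV_cons n).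

End measurable_row_theory.

Section lebesgue_rV_succ.
Local Open Scope ereal_scope.
Context {R : realType} {n : nat}.
Variable m : {sigma_finite_measure set 'rV[R]_n -> \bar R}.

Definition lebesgue_rV_succ : set 'rV[R]_n.+1 -> \bar R :=
  pushforward (@lebesgue_measure R \x m) (@rV_cons R n).

Let succ0 : lebesgue_rV_succ set0 = 0.
Proof. exact: measure0. Qed.

Let succ_ge0 A : 0 <= lebesgue_rV_succ A.
Proof. exact: measure_ge0. Qed.

Let succ_sigma_additive : semi_sigma_additive lebesgue_rV_succ.
Proof. exact: measure_semi_sigma_additive. Qed.

HB.instance Definition _ := isMeasure.Build _ _ _ lebesgue_rV_succ
  succ0 succ_ge0 succ_sigma_additive.

Let succ_sigma_finite : sigma_finite setT lebesgue_rV_succ.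
Proof.
have [H TH Hoo] : sigma_finite setT (@lebesgue_measure R \x m).
  have /sigma_finiteP[F [TF ndF Foo]] := sigma_finiteT (@lebesgue_measure R).
  have /sigma_finiteP[G [TG ndG Goo]] := sigma_finiteT m.
  exists (fun k => F k `*` G k) => [|k].
    rewrite -setXTT TF TG predeqE => -[x y]; split.
      move=> [/= [i _ Fix] [j _ Gjy]]; exists (maxn i j) => //; split.
      - by move: x Fix; exact/subsetPset/ndF/leq_maxl.
      - by move: y Gjy; exact/subsetPset/ndG/leq_maxr.
    by move=> [i _ []/= ? ?]; split; exists i.
  have [? ?] := Foo k; have [? ?] := Goo k; split; first exact: measurableX.
  by rewrite product_measure1E// lte_mul_pinfty// ge0_fin_numE.
pose g (x : 'rV[R]_n.+1) : measurableTypeR R * 'rV[R]_n :=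
  (lsubmx (x : 'rV_(1 + n)) 0%R 0%R, rsubmx (x : 'rV_(1 + n))).
have consK : cancel (@rV_cons R n) g.
  by case=> a b; rewrite /g /rV_cons /= row_mxKl row_mxKr mxE eqxx mulr1n.
have mg : measurable_fun setT g.
  apply/measurable_fun_pairP; split => /=.
    rewrite [X in measurable_fun _ X](_ : _ = fun x : 'rV[R]_n.+1 => x 0%R ord0).
      exact: measurable_coord.
    by apply/funext => x /=; rewrite /g/= mxE; congr (x _ _); apply/val_inj.
  apply: measurable_fun_rowP => i.
  rewrite [X in measurable_fun _ X](_ : _ =
      fun x : 'rV[R]_n.+1 => x 0%R (rshift 1 i : 'I_n.+1)).
    exact: measurable_coord.
  by apply/funext => x /=; rewrite /g/= mxE.
exists (fun k => g @^-1` H k) => [|k].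
  by rewrite -preimage_bigcup -TH preimage_setT.
have [mH Hk] := Hoo k; split.
  by rewrite -[X in measurable X]setTI; exact: mg.
rewrite /lebesgue_rV_succ /pushforward -comp_preimage.
by rewrite (_ : g \o _ = id) ?preimage_id//; apply/funext => p; exact: consK.
Qed.

HB.instance Definition _ := Measure_isSigmaFinite.Build _ _ _ lebesgue_rV_succ
  succ_sigma_finite.

End lebesgue_rV_succ.

(* Lebesgue measure on R^n (restricted to the Borel sets), as the n-fold       *)
(* product of the one-dimensional one; see lebesgue_rV_box.                    *)
Fixpoint lebesgue_rV {R : realType} (n : nat) :
    {sigma_finite_measure set 'rV[R]_n -> \bar R} :=
  match n with
  | 0 => \d_(0%R : 'rV[R]_0)
  | n.+1 => lebesgue_rV_succ (lebesgue_rV n)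
  end.

Lemma lebesgue_rV_box (R : realType) n (a b : 'I_n -> R) :
  (forall i, a i <= b i) ->
  lebesgue_rV n [set x : 'rV[R]_n | forall i, x 0 i \in `[a i, b i]] =
  (\prod_(i < n) (b i - a i))%:E.
Proof.
elim: n => [|n IH] in a b * => ab.
  rewrite big_ord0 /= diracE (_ : (_ \in _) = true)//.
  by apply/mem_set => -[].
rewrite big_ord_recl EFinM /= /lebesgue_rV_succ /pushforward.
set tl := [set x : 'rV[R]_n |
  forall i, x 0 i \in `[a (lift ord0 i), b (lift ord0 i)]].
rewrite (_ : _ @^-1` _ = `[a ord0, b ord0]%classic `*` tl); last first.
  have hd s y : (rV_cons (s, y) : 'rV[R]_n.+1) 0 ord0 = s.
    have -> : ord0 = lshift n (ord0 : 'I_1) :> 'I_(1 + n) by apply/val_inj.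
    by rewrite [LHS]row_mxEl mxE eqxx mulr1n.
  have tlE s y i : (rV_cons (s, y) : 'rV[R]_n.+1) 0 (lift ord0 i) = y 0 i.
    have -> : lift ord0 i = rshift 1 i :> 'I_(1 + n) by apply/val_inj.
    by rewrite [LHS]row_mxEr.
  apply/seteqP; split => -[/= s y] => [sy|[sab yab] i].
    by split=> [|i]; [have := sy ord0; rewrite hd|
                      have := sy (lift ord0 i); rewrite tlE].
  by case: (unliftP ord0 i) => [j|] ->; rewrite ?hd ?tlE//; exact: yab.
have mtl : measurable tl.
  rewrite (_ : tl = \bigcap_(i in [set: 'I_n]) ((fun x : 'rV[R]_n => x 0 i) @^-1`
      `[a (lift ord0 i), b (lift ord0 i)])); last first.
    by apply/seteqP; split => x /= tx i; [move=> _; exact: tx|exact: tx].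
  apply: fin_bigcap_measurable => // i _.
  by rewrite -[X in measurable X]setTI; exact: measurable_coord.
rewrite product_measure1E; [|exact: (measurable_itv `[a ord0, b ord0])|exact: mtl].
have lab := lebesgue_measure_itv `[a ord0, b ord0].
rewrite (IH _ _ (fun i => ab _)); congr (_ * _)%E; apply: (etrans lab).
rewrite /= lte_fin.
by case: ltgtP (ab ord0) => // -> _; rewrite subrr.
Qed.

Section euclidean.
Context {R : realType} {N : nat}.
Implicit Types (x y : 'rV[R]_N) (D : set 'rV[R]_N) (u : 'rV[R]_N -> R).

(* The library norm on row vectors is the sup norm, so the Euclidean norm and  *)
(* its balls are introduced here.                                              *)
Definition dotp x y : R := \sum_i x 0 i * y 0 i.
Definition enorm x : R := Num.sqrt (dotp x x).
Definition eball r : set 'rV[R]_N := [set x | enorm x < r].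
Definition ecball r : set 'rV[R]_N := [set x | enorm x <= r].
Definition esphere r : set 'rV[R]_N := [set x | enorm x = r].

Definition radial D u :=
  forall x y, D x -> D y -> enorm x = enorm y -> u x = u y.

(* Decreasing is understood in the wide sense, the weakest hypothesis.         *)
Definition radially_decreasing D u := radial D u /\
  forall x y, D x -> D y -> enorm x <= enorm y -> u y <= u x.

Definition evec i : 'rV[R]_N := delta_mx 0 i.

Definition grad u x : 'rV[R]_N := \row_i 'D_(evec i) u x.

Definition partials (s : seq 'I_N) u : 'rV[R]_N -> R :=
  foldr (fun i v => 'D_(evec i) v) u s.

Definition smooth u := forall s : seq 'I_N,
  continuous (partials s u) /\
  forall i x, derivable (partials s u) x (evec i).

Definition test_function D u :=
  let supp := closure [set x | u x != 0] in
  [/\ smooth u, compact supp & supp `<=` D].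

(* C^{1,a} on the closed ball: the gradient on the open ball extends to an     *)
(* a-Hoelder field on the closed ball. Values of u outside the closed ball     *)
(* play no role.                                                               *)
Definition C1_holder (a r : R) u :=
  [/\ {within ecball r, continuous u},
      forall x i, eball r x -> derivable u x (evec i) &
      exists2 G : 'rV[R]_N -> 'rV[R]_N,
        forall x, eball r x -> G x = grad u x &
        exists C : R, forall x y, ecball r x -> ecball r y ->
          enorm (G x - G y) <= C * enorm (x - y) `^ a].

(* Derivative along the outward unit normal x / r at a point x of the sphere   *)
(* of radius r, one-sided from inside the ball.                                *)
Definition is_normal_derivative (r : R) u x (d : R) :=
  (fun t : R => t^-1 * (u (x + t *: (r^-1 *: x)) - u x)) @ 0^'- --> d.

(* |xi|^(s-2) xi, which vanishes at xi = 0 as it should for 1 < s.             *)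
Definition flux (s : R) (xi : 'rV[R]_N) : 'rV[R]_N := enorm xi `^ (s - 2) *: xi.

(* c / u^delta + h, with value +oo where u vanishes.                           *)
Definition source (c delta : R) (h u : 'rV[R]_N -> R) x : \bar R :=
  (c%:E / (u x `^ delta)%:E + (h x)%:E)%E.

Definition loc_integrable D (f : 'rV[R]_N -> \bar R) :=
  forall K, compact K -> K `<=` D -> (lebesgue_rV N).-integrable K f.

(* Distributional solution of the Dirichlet problem; requiring the right-hand  *)
(* side to be locally integrable is what makes it a distribution, positivity   *)
(* of u is not assumed.                                                        *)
Definition weak_solution (p q c delta r : R) (h u : 'rV[R]_N -> R) :=
  [/\ forall x, esphere r x -> u x = 0,
      loc_integrable (eball r) (source c delta h u) &
      forall phi, test_function (eball r) phi ->
        (\int[lebesgue_rV N]_(x in eball r)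
          (dotp (flux p (grad u x) + flux q (grad u x))%R (grad phi x))%:E =
        \int[lebesgue_rV N]_(x in eball r)
          (source c delta h u x * (phi x)%:E))%E].

End euclidean.

(* Main.v *)
From HB Require Import structures.
Require Import Defs.
From mathcomp Require Import all_boot all_order all_algebra.
From mathcomp Require Import all_classical all_reals all_analysis.
From mathcomp Require Import measurable_realfun ring lra.
Import Order.TTheory GRing.Theory Num.Theory.
Import numFieldNormedType.Exports.
Set Implicit Arguments.
Unset Strict Implicit.
Unset Printing Implicit Defensive.
Local Open Scope classical_set_scope.
Local Open Scope ring_scope.

(** Write [u(x) = U(|x|)] for a solution, [v = -U' >= 0], and
    [a(t) = t^(p-1) + t^(q-1)].

    Reduction to a radial equation. The solution is first shown to be positive:
    it is nonnegative and decreasing, so a zero inside the ball would make it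
    vanish on a shell, where the source is infinite and not integrable
    ([solution_gt0]). Then the distributional equation is tested against
    [psi(|x|^2)], where [psi] is a smooth cutoff falling from 1 to 0 across a
    thin shell. Letting the shell shrink to the sphere of radius [t] gives
      [N w t^(N-1) a(v(t)) = int_(|x| <= t) (c / u^delta + h)],
    with [w] the volume of the unit ball ([ball_mass_flux]). The surface measure
    never appears: the integral of [psi'(|x|^2) |x|^2] is computed from the
    behaviour of Lebesgue measure under dilations ([integral_cutoff_slope]).
    Differentiating in [t] gives ([radial_solution])
      [(t^(N-1) a(v))' = t^(N-1) (c / U^delta + h)].

    Comparison. Let [W = U2 - U1] and let [Z] be the difference of the flows
    [t^(N-1) a(v_i)], so that [W'] and [Z] have opposite signs. At a negative
    minimum of [W] one has [Z = 0], while [Z' > 0] as long as [W < 0]; hence [W]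
    decreases further to the right of its minimum, a contradiction, and
    [W >= 0] ([profile_le]). If [W] vanishes at some [t0 < r], then [t0] is a
    minimum of [W], so [Z(t0) = 0] as well, and this Cauchy datum propagates to
    both sides ([profile_eq_right], [profile_eq_left]): on a short interval any
    bound on [W] improves by a factor 2. By connectedness [W = 0], which forces
    [h1 = h2]. Finally [v1(r) < v2(r)], for otherwise [W(r) = 0] and
    [Z(r) <= 0], which propagates to the left although the equation is singular
    at [r]: there [U1(t)] is at least of order [r - t], so that with
    [W <= C (r - t)] the right-hand side is of order [C (r - t)^(-delta)], which
    is integrable because [delta < 1].

    The bound [q <= 2] enters because [a] then has a locally Lipschitz inverse,
    which turns bounds on [Z] into bounds on [W']. *)

(** * Calculus on the line *)

Lemma within_cont_B (R : realType) (f g : R -> R) (A : set R) :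
  {within A, continuous f} -> {within A, continuous g} ->
  {within A, continuous (fun t => f t - g t)}.
Proof.
move=> cf cg; apply/subspace_continuousP => x Ax; apply: cvgB.
  by move/subspace_continuousP : cf => /(_ x Ax).
by move/subspace_continuousP : cg => /(_ x Ax).
Qed.

Section real_calculus.
Context {R : realType}.
Implicit Types (f df : R -> R) (a b : R).

Lemma within_cont_lt f a b t k : {within `[a, b], continuous f} ->
  t \in `[a, b] -> f t < k ->
  exists2 e, 0 < e & forall s, s \in `[a, b] -> `|s - t| < e -> f s < k.
Proof.
move=> cf tab ftk.
have /subspace_continuousP/(_ t tab) := cf.
move/cvgrPdist_lt => /(_ (k - f t)); rewrite subr_gt0 => /(_ ftk).
case => e /= e0 H; exists e => // s sab st.
have sE : `|t - s| < e by rewrite distrC.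
have Hs : `|f s - f t| < k - f t by rewrite distrC; exact: H.
by have := le_lt_trans (ler_norm _) Hs; rewrite ltrBlDr subrK.
Qed.

Lemma mvt_exists f df a b : a < b -> {within `[a, b], continuous f} ->
  (forall x, a < x < b -> is_derive x 1 f (df x)) ->
  exists2 x, a < x < b & f b - f a = df x * (b - a).
Proof.
move=> ab cf dfx.
have dfx' x : x \in `]a, b[ -> is_derive x 1 f (df x).
  by rewrite in_itv/= => /dfx.
by have [c] := MVT ab dfx' cf; rewrite in_itv/= => cab E; exists c.
Qed.

Lemma within_cont_sub f a b c d : {within `[a, b], continuous f} ->
  a <= c -> d <= b -> {within `[c, d], continuous f}.
Proof.
move=> cf ac db; apply: continuous_subspaceW cf => x /=.
by rewrite !in_itv/= => /andP[? ?]; apply/andP; split; lra.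
Qed.

Lemma dyadic_le0 (x B : R) : (forall k : nat, x <= B / 2 ^+ k) -> x <= 0.
Proof.
move=> H; rewrite leNgt; apply/negP => x0.
have B0 : 0 < B by have := H 0%N; rewrite expr0 divr1; lra.
have [k Hk] : exists k : nat, B / x < k%:R.
  by exists (Num.bound (B / x)); apply: archi_boundP; rewrite divr_ge0// ltW.
have k2 : k%:R < 2 ^+ k :> R by rewrite -natrX ltr_nat ltn_expl.
have := H k; rewrite ler_pdivlMr ?exprn_gt0//.
move: Hk; rewrite ltr_pdivrMr// => Hk.
have : x * k%:R < x * 2 ^+ k by rewrite ltr_pM2l.
by rewrite mulrC => /(lt_trans Hk) /lt_le_trans h /h; rewrite ltxx.
Qed.

(** A contraction argument without suprema: a bound [B w] that can always be
    improved by a factor 2 forces [f <= 0]. The weight [w] lets the bound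
    degenerate at an end of the interval. *)
Lemma halving_le0 (I : set R) (f w : R -> R) (B : R) : 0 <= B ->
  (forall s, I s -> f s <= B * w s) ->
  (forall C, 0 <= C -> (forall s, I s -> f s <= C * w s) ->
     forall s, I s -> f s <= C / 2 * w s) ->
  forall s, I s -> f s <= 0.
Proof.
move=> B0 HB step s Is; apply: (@dyadic_le0 _ (B * w s)) => k.
have -> : B * w s / 2 ^+ k = B / 2 ^+ k * w s by rewrite mulrAC.
elim: k s Is => [|k IH] s Is; first by rewrite expr0 divr1; exact: HB.
have -> : B / 2 ^+ k.+1 = B / 2 ^+ k / 2.
  by rewrite exprSr invfM mulrA.
by apply: step => //; rewrite divr_ge0// exprn_ge0.
Qed.

(** Limit passages of the estimates on thin shells, where the radius [t] and the
    slope [k] are both known up to [x]. *)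
Lemma le_perturbed_monomial (N : nat) (K k c0 t e : R) : 0 < t -> 0 < e ->
  (forall x, 0 < x < e -> K <= (k + x) * (c0 * (t + x) ^+ N)) ->
  K <= k * (c0 * t ^+ N).
Proof.
move=> t0 e0 HK; rewrite leNgt; apply/negP => lt.
pose g (x : R) := (k + x) * (c0 * (t + x) ^+ N).
have cg : {within `[0, e], continuous g}.
  apply: continuous_subspaceT => x.
  apply: cvgM; first by apply: cvgD; [exact: cvg_cst|exact: cvg_id].
  apply: cvgMr; apply: (@continuous_comp _ _ _ (fun x => t + x) (fun y => y ^+ N)).
    by apply: cvgD; [exact: cvg_cst|exact: cvg_id].
  exact: exprn_continuous.
have g0 : g 0 < K by rewrite /g !addr0.
have e00 : 0 \in `[0, e] by rewrite in_itv/= lexx ltW.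
have [d d0 Hd] := within_cont_lt cg e00 g0.
pose x := Num.min (d / 2) (e / 2).
have x0 : 0 < x by rewrite lt_min !divr_gt0.
have xd : x <= d / 2 by rewrite ge_min lexx.
have xe : x <= e / 2 by rewrite ge_min lexx orbT.
have : g x < K by apply: Hd; [rewrite in_itv/=; lra|rewrite subr0 gtr0_norm//; lra].
by rewrite ltNge HK// x0/=; lra.
Qed.

Lemma ge_perturbed_monomial (N : nat) (K k c0 t e : R) : 0 < t -> 0 < e ->
  (forall x, 0 < x < e -> (k - x) * (c0 * (t - x) ^+ N) <= K) ->
  k * (c0 * t ^+ N) <= K.
Proof.
move=> t0 e0 HK; rewrite leNgt; apply/negP => lt.
pose g (x : R) := - ((k - x) * (c0 * (t - x) ^+ N)).
have cg : {within `[0, e], continuous g}.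
  apply: continuous_subspaceT => x; apply: cvgN.
  apply: cvgM; first by apply: cvgB; [exact: cvg_cst|exact: cvg_id].
  apply: cvgMr; apply: (@continuous_comp _ _ _ (fun x => t - x) (fun y => y ^+ N)).
    by apply: cvgB; [exact: cvg_cst|exact: cvg_id].
  exact: exprn_continuous.
have g0 : g 0 < - K by rewrite /g !subr0 ltrN2.
have e00 : 0 \in `[0, e] by rewrite in_itv/= lexx ltW.
have [d d0 Hd] := within_cont_lt cg e00 g0.
pose x := Num.min (d / 2) (e / 2).
have x0 : 0 < x by rewrite lt_min !divr_gt0.
have xd : x <= d / 2 by rewrite ge_min lexx.
have xe : x <= e / 2 by rewrite ge_min lexx orbT.
have : g x < - K by apply: Hd; [rewrite in_itv/=; lra|rewrite subr0 gtr0_norm//; lra].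
by rewrite ltNge lerN2 HK// x0/=; lra.
Qed.

(** Factor out [x^(-d)] and use [z <= z^d] for [z = x / y], which is at most 1. *)
Lemma powR_le_lipschitz (x y d : R) : 0 < x -> x <= y -> 0 < d <= 1 ->
  x `^ (- d) - y `^ (- d) <= x `^ (- d) * (y - x) / x.
Proof.
move=> x0 xy /andP[d0 d1].
have y0 : 0 < y by lra.
have z0 : 0 < x / y <= 1 by rewrite divr_gt0//= ler_pdivrMr// mul1r.
have E : y `^ (- d) = x `^ (- d) * (x / y) `^ d.
  rewrite powRM ?invr_ge0 ?ltW// mulrA -powRD; last first.
    by apply/implyP => _; rewrite gt_eqF.
  by rewrite addNr powRr0 mul1r -powR_inv1 ?ltW// -powRrM mulN1r.
rewrite E -{1}(mulr1 (x `^ _)) -mulrBr -mulrA ler_pM2l ?powR_gt0//.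
have := ger1_powR z0 d1.
have : (y - x) / y <= (y - x) / x.
  by rewrite ler_wpM2l ?subr_ge0// lef_pV2 ?posrE.
rewrite mulrBl divff ?gt_eqF//; lra.
Qed.

Lemma powR_cvg_at0 (g : R) : 0 < g -> forall e : R, 0 < e ->
  exists2 d : R, 0 < d & forall x : R, 0 <= x -> x <= d -> x `^ g <= e.
Proof.
move=> g0 e e0; exists (e `^ g^-1); first exact: powR_gt0.
move=> x x0 xd; have := @ge0_ler_powR _ g (ltW g0) x (e `^ g^-1).
rewrite !nnegrE powR_ge0 => /(_ x0 isT xd).
by rewrite -powRrM mulVf ?gt_eqF// powRr1 ?(ltW e0).
Qed.

Lemma powR_within_continuous (g a b : R) : 0 < g -> 0 <= a ->
  {within `[a, b], continuous (fun x => x `^ g)}.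
Proof.
move=> g0 a0; apply/subspace_continuousP => x /=; rewrite in_itv/= => /andP[ax xb].
have [x0|x0] := ltP 0 x.
  apply: cvg_within_filter.
  apply/differentiable_continuous/derivable1_diffP.
  by apply: derivable_powR; rewrite in_itv/= andbT.
have -> : x = 0 by lra.
suff : (y : R) `^ g @[y --> within `[a, b] (nbhs (0 : R))] --> (0 : R) `^ g by [].
apply/cvgrPdist_le => e e0; rewrite powR0 ?gt_eqF//.
have [d d0 H] := powR_cvg_at0 g0 e0.
exists d => //= y; rewrite /ball_/= !sub0r !normrN in_itv/= => yd /andP[ay _].
rewrite ger0_norm ?powR_ge0//; apply: H; first lra.
exact: le_trans (ler_norm _) (ltW yd).
Qed.

(** For [g <= 1] the derivative of [t^g] is smallest at the right end [M]. *)
Lemma powR_inv_lipschitz (g M : R) : 0 < g <= 1 -> 0 < M ->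
  forall s t : R, 0 <= s -> s <= t -> t <= M ->
  t - s <= (g * M `^ (g - 1))^-1 * (t `^ g - s `^ g).
Proof.
move=> /andP[g0 g1] M0 s t s0 st tM.
have L0 : 0 < g * M `^ (g - 1) by rewrite mulr_gt0// powR_gt0.
have [->|st'] := eqVneq s t; first by rewrite !subrr mulr0.
have {}st : s < t by rewrite lt_neqAle st' st.
have [x|x /andP[sx xt] ->] := @mvt_exists (fun x => x `^ g)
    (fun x => g * x `^ (g - 1)) s t st (@powR_within_continuous g s t g0 s0).
  by move=> /andP[sx xt]; apply: is_derive1_powR; lra.
rewrite mulrA; apply: ler_peMl; first lra.
rewrite [leRHS]mulrC ler_pdivlMr// mul1r ler_pM2l//.
have -> : g - 1 = - (1 - g) by ring.
rewrite !powRN lef_pV2 ?posrE ?powR_gt0//; last lra.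
by apply: ge0_ler_powR; rewrite ?nnegrE; lra.
Qed.

End real_calculus.

(** * Strong comparison for the radial equation *)

(** Turns bounds on differences of flows into bounds on differences of slopes;
    it also makes [a] strictly increasing on the nonnegative reals. *)
Definition inverse_lipschitz (R : realType) (a : R -> R) :=
  forall M : R, exists2 L : R, 0 < L &
    forall s t : R, 0 <= s -> s <= t -> t <= M -> t - s <= L * (a t - a s).

(** A positive solution [U] of the radial equation in dimension [n + 1], with
    [v = -U'] continuous up to both ends. The equation is carried by the flow
    [t^n a(v)] as a whole, since [v] itself may fail to be differentiable. *)
Record radial_profile (R : realType) (n : nat) (a : R -> R) (c d r : R)
    (h U v : R -> R) : Prop := RadialProfile {
  profile_cont : {within `[0, r], continuous U};
  slope_cont : {within `[0, r], continuous v};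
  flow_cont : {within `[0, r], continuous (fun t => t ^+ n * a (v t))};
  slope_ge0 : forall t : R, 0 <= t <= r -> 0 <= v t;
  profile_deriv : forall t : R, 0 < t < r -> is_derive t 1 U (- v t);
  flow_deriv : forall t : R, 0 < t < r ->
    is_derive t 1 (fun t => t ^+ n * a (v t)) (t ^+ n * (c * U t `^ (- d) + h t));
  flow0 : 0 ^+ n * a (v 0) = 0;
  profile_end : U r = 0;
  profile_gt0 : forall t : R, 0 <= t < r -> 0 < U t }.

Section radial_comparison.
Context {R : realType}.
Implicit Types s t : R.
Variables (n : nat) (a : R -> R) (c d r : R).
Hypotheses (ha : inverse_lipschitz a) (a0 : a 0 = 0).
Hypotheses (c_gt0 : 0 < c) (d_gt0 : 0 < d) (d_lt1 : d < 1) (r_gt0 : 0 < r).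

Lemma inverse_lipschitz_lt s t : 0 <= s -> 0 <= t -> a s < a t -> s < t.
Proof.
move=> s0 t0 ast; rewrite ltNge; apply/negP => ts.
have [L L0 H] := ha s.
have := H t s t0 ts (lexx _); have : L * (a s - a t) < 0 by rewrite pmulr_rlt0// subr_lt0.
lra.
Qed.

Lemma slope_bounded h U v : radial_profile n a c d r h U v ->
  exists2 M, 0 < M & forall t, 0 <= t <= r -> v t <= M.
Proof.
move=> P; have [m mr H] := EVT_max (ltW r_gt0) (slope_cont P).
exists (v m + 1).
  have : 0 <= v m by apply: (slope_ge0 P); move: mr; rewrite in_itv.
  lra.
move=> t tr; have : v t <= v m by apply: H; rewrite in_itv.
lra.
Qed.

Lemma slope_gt0 h U v : radial_profile n a c d r h U v ->
  (forall t, 0 < t < r -> 0 <= h t) -> forall t, 0 < t <= r -> 0 < v t.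
Proof.
move=> P h0 t /andP[t0 tr].
have t0r : 0 <= t <= r by lra.
apply: inverse_lipschitz_lt; rewrite ?(slope_ge0 P) ?a0//.
have [x /andP[x0 xt]] := mvt_exists t0 (within_cont_sub (flow_cont P) (lexx _) tr)
   (fun x (xt : 0 < x < t) => flow_deriv P (t := x) ltac:(lra)).
rewrite (flow0 P) !subr0 => E.
have x0r : 0 < x < r by lra.
have : 0 < t ^+ n * a (v t).
  rewrite E mulr_gt0// mulr_gt0 ?exprn_gt0//; apply: ltr_pwDl; last exact: h0.
  by rewrite mulr_gt0// powR_gt0// (profile_gt0 P)//; lra.
by rewrite pmulr_rgt0 ?exprn_gt0.
Qed.

Lemma profile_nincr h U v : radial_profile n a c d r h U v ->
  forall s t, 0 <= s -> s <= t -> t <= r -> U t <= U s.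
Proof.
move=> P s t s0; rewrite le_eqVlt => /predU1P[->//|st] tr.
have [x /andP[sx xt] E] := mvt_exists st (within_cont_sub (profile_cont P) s0 tr)
   (fun x (xt : s < x < t) => profile_deriv P (t := x) ltac:(lra)).
have vx : 0 <= v x by apply: (slope_ge0 P); lra.
have : 0 <= v x * (t - s) by rewrite mulr_ge0//; lra.
lra.
Qed.

Variables (h1 h2 U1 U2 v1 v2 : R -> R).
Hypotheses (P1 : radial_profile n a c d r h1 U1 v1).
Hypotheses (P2 : radial_profile n a c d r h2 U2 v2).
Hypothesis (h1_ge0 : forall t, 0 < t < r -> 0 <= h1 t).
Hypothesis (h12 : forall t, 0 < t < r -> h1 t <= h2 t).

Let W t := U2 t - U1 t.
Let Z t := t ^+ n * a (v2 t) - t ^+ n * a (v1 t).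

Let W_cont : {within `[0, r], continuous W}.
Proof. exact: within_cont_B (profile_cont P2) (profile_cont P1). Qed.

Let Z_cont : {within `[0, r], continuous Z}.
Proof. exact: within_cont_B (flow_cont P2) (flow_cont P1). Qed.

Let W_deriv t : 0 < t < r -> is_derive t 1 W (v1 t - v2 t).
Proof.
move=> tr; have D1 := profile_deriv P1 tr; have D2 := profile_deriv P2 tr.
by apply: is_derive_eq; rewrite opprK addrC.
Qed.

Let Z' (t : R) := t ^+ n * (c * (U2 t `^ (- d) - U1 t `^ (- d)) + (h2 t - h1 t)).

Let Z_deriv t : 0 < t < r -> is_derive t 1 Z (Z' t).
Proof.
move=> tr; have D1 := flow_deriv P1 tr; have D2 := flow_deriv P2 tr.
by apply: is_derive_eq; rewrite /Z'; ring.
Qed.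

Let W_mvt s t : 0 <= s -> s < t -> t <= r ->
  exists2 x, s < x < t & W t - W s = (v1 x - v2 x) * (t - s).
Proof.
move=> s0 st tr; apply: mvt_exists st (within_cont_sub W_cont s0 tr) _.
by move=> x xst; apply: W_deriv; lra.
Qed.

Let Z_mvt s t : 0 <= s -> s < t -> t <= r ->
  exists2 x, s < x < t & Z t - Z s = Z' x * (t - s).
Proof.
move=> s0 st tr; apply: mvt_exists st (within_cont_sub Z_cont s0 tr) _.
by move=> x xst; apply: Z_deriv; lra.
Qed.

Let W_end : W r = 0.
Proof. by rewrite /W (profile_end P1) (profile_end P2) subrr. Qed.

(** At an interior minimum [W' = 0], that is [v1 = v2]; at the centre both flows
    vanish. *)
Let Z_W_critical t : 0 <= t < r -> (forall s, 0 <= s <= r -> W t <= W s) -> Z t = 0.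
Proof.
move=> /andP[t0 tr] Wmin; move: t0; rewrite le_eqVlt => /predU1P[<-|t0].
  by rewrite /Z (flow0 P1) (flow0 P2) subrr.
have tin : t \in `]0, r[ by rewrite in_itv/= t0.
have D0 : is_derive t 1 W 0.
  apply: (derive1_at_min (ltW r_gt0) _ tin).
    by move=> s; rewrite in_itv/= => /W_deriv[].
  by move=> s; rewrite in_itv/= => sr; apply: Wmin; lra.
have tr' : 0 < t < r by rewrite t0.
have := @derive_val _ _ _ _ _ _ _ (W_deriv tr').
rewrite (@derive_val _ _ _ _ _ _ _ D0) => /esym/eqP; rewrite subr_eq0 => /eqP E.
by rewrite /Z E subrr.
Qed.

Let slope_le B t : 0 < t <= r -> 0 <= B -> - (t ^+ n * B) <= Z t ->
  - B <= a (v2 t) - a (v1 t).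
Proof.
move=> /andP[t0 tr] B0; rewrite /Z -mulrBr -mulrN ler_pM2l// exprn_gt0//.
Qed.

(** Weak comparison, by looking just to the right of a negative minimum of [W],
    where the sign of [W] makes [Z] increase from 0. *)
Lemma profile_le t : 0 <= t <= r -> U1 t <= U2 t.
Proof.
move=> tr; rewrite -subr_ge0 -/(W t).
have [m mr Wmin] := EVT_min (ltW r_gt0) W_cont.
apply: le_trans (Wmin t _); last by rewrite in_itv.
rewrite leNgt; apply/negP => Wm0.
move: (mr); rewrite in_itv/= => /andP[m0 mler].
have mr' : m < r.
  rewrite lt_neqAle mler andbT; apply/eqP => mE.
  by move: Wm0; rewrite mE W_end ltxx.
have Zm : Z m = 0.
  by apply: Z_W_critical => [|s sr]; [rewrite m0|apply: Wmin; rewrite in_itv].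
have [e e0 He] := within_cont_lt W_cont mr Wm0.
pose t' := Num.min (m + e / 2) r.
have mt' : m < t' by rewrite /t' lt_min mr' andbT; lra.
have t'r : t' <= r by rewrite /t' ge_min lexx orbT.
have t'e : t' <= m + e / 2 by rewrite /t' ge_min lexx.
have Wneg x : m <= x -> x <= t' -> W x < 0.
  move=> mx xt; apply: He; first by rewrite in_itv/=; lra.
  by rewrite ger0_norm; lra.
have Zpos x : m < x -> x < t' -> 0 < Z x.
  move=> mx xt; have [y /andP[my yx]] := Z_mvt m0 mx ltac:(lra).
  rewrite Zm subr0 => ->; rewrite mulr_gt0 ?subr_gt0// /Z' mulr_gt0 ?exprn_gt0//; first lra.
  apply: ltr_pwDl; last by rewrite subr_ge0 h12//; lra.
  rewrite mulr_gt0// subr_gt0 !powRN ltf_pV2 ?posrE ?powR_gt0 ?(profile_gt0 P1)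
    ?(profile_gt0 P2)//; try lra.
  have U20 : 0 < U2 y by apply: (profile_gt0 P2); lra.
  have := Wneg y (ltW my) ltac:(lra); rewrite /W subr_lt0 => U21.
  by apply: gt0_ltr_powR; rewrite ?nnegrE //; lra. 
have [x /andP[mx xt] E] := W_mvt m0 mt' t'r.
have v12 : v1 x < v2 x.
  apply: inverse_lipschitz_lt; [apply: (slope_ge0 P1); lra|apply: (slope_ge0 P2); lra|].
  have := Zpos x mx xt; rewrite /Z -mulrBr pmulr_rgt0 ?subr_gt0// exprn_gt0//; lra.
have : (v1 x - v2 x) * (t' - m) < 0 by rewrite pmulr_llt0; lra.
have : W m <= W t' by apply: Wmin; rewrite in_itv/=; lra.
lra.
Qed.

Let W_ge0 t : 0 <= t <= r -> 0 <= W t.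
Proof. by move=> tr; rewrite subr_ge0 profile_le. Qed.

(** When [W >= 0] the singular terms can only decrease [Z], and by no more than
    [c U1^(-d) W / U1]. *)
Let Z'_ge K t : 0 < t < r -> c * U1 t `^ (- d) * W t / U1 t <= K ->
  - (t ^+ n * K) <= Z' t.
Proof.
move=> /andP[t0 tr] HK; rewrite /Z' -mulrN ler_pM2l ?exprn_gt0//.
have U10 : 0 < U1 t by apply: (profile_gt0 P1); lra.
have U12 : U1 t <= U2 t by apply: profile_le; lra.
have := @powR_le_lipschitz _ _ _ d U10 U12; rewrite d_gt0 ltW// => /(_ isT) H.
have h0 : 0 <= h2 t - h1 t by rewrite subr_ge0 h12//; lra.
have : c * (U1 t `^ (- d) - U2 t `^ (- d)) <= c * (U1 t `^ (- d) * (U2 t - U1 t) / U1 t).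
  by rewrite ler_pM2l.
move: HK; rewrite /W !mulrA; lra.
Qed.

Let slope_diff_le M L B t : (forall s t, 0 <= s -> s <= t -> t <= M -> t - s <= L * (a t - a s)) ->
  (forall t, 0 <= t <= r -> v1 t <= M) -> 0 <= L ->
  0 < t <= r -> 0 <= B -> - (t ^+ n * B) <= Z t -> v1 t - v2 t <= L * B.
Proof.
move=> HL HM L0 tr B0 ZB; have v10 : 0 <= v1 t by apply: (slope_ge0 P1); lra.
have v20 : 0 <= v2 t by apply: (slope_ge0 P2); lra.
have [v12|v21] := leP (v1 t) (v2 t).
  have LB : 0 <= L * B by rewrite mulr_ge0.
  lra.
have v1M : v1 t <= M by apply: HM; lra.
apply: le_trans (HL _ _ v20 (ltW v21) v1M) _; rewrite ler_wpM2l//.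
by have := slope_le tr B0 ZB; lra.
Qed.

(** Integrating the lower bound on [Z'] from [t0]. The factor [y^n] is kept, for
    it is divided out again when [t0 = 0]. *)
Let flow_gap_ge_right t0 t1 m C : 0 <= t0 -> t1 < r -> 0 < m -> 0 <= C ->
  0 <= Z t0 ->
  (forall s, t0 < s < t1 -> m <= U1 s) -> (forall s, t0 < s < t1 -> W s <= C) ->
  forall y, t0 < y < t1 ->
    - (y ^+ n * (c * m `^ (- d) / m * C * (y - t0))) <= Z y.
Proof.
move=> t00 t1r m0 C0 Z0 HU HW y /andP[y0 yt1].
have [z /andP[z0 zy] E] := Z_mvt t00 y0 ltac:(lra).
set K := c * m `^ (- d) / m.
have K0 : 0 < K by rewrite divr_gt0// mulr_gt0// powR_gt0.
have zr : 0 < z < r by lra.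
have zt1 : t0 < z < t1 by lra.
have yt0 : 0 <= y - t0 by lra.
have Zz : - (z ^+ n * (K * C)) <= Z' z.
  apply: Z'_ge => //.
  have U1z := HU z zt1; have Wz := HW z zt1.
  have Wz0 : 0 <= W z by apply: W_ge0; lra.
  have U10 : 0 < U1 z := lt_le_trans m0 U1z.
  rewrite /K -!mulrA ler_pM2l// ler_pM ?powR_ge0 ?divr_ge0 ?(ltW U10)//.
    rewrite !powRN lef_pV2 ?posrE ?powR_gt0//.
    by apply: (ge0_ler_powR (ltW d_gt0)); rewrite ?nnegrE ?(ltW m0) ?(ltW U10).
  by rewrite mulrC ler_pM ?invr_ge0 ?(ltW U10)// lef_pV2 ?posrE.
have zge0 : 0 <= z by lra.
have yge0 : 0 <= y by lra.
have KC0 : 0 <= K * C by rewrite mulr_ge0// ltW.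
have zny : z ^+ n * (K * C) <= y ^+ n * (K * C).
  by rewrite ler_wpM2r// lerXn2r ?nnegrE// ltW.
have H1 : - (z ^+ n * (K * C)) * (y - t0) <= Z' z * (y - t0).
  by rewrite ler_wpM2r.
have H2 : z ^+ n * (K * C) * (y - t0) <= y ^+ n * (K * C) * (y - t0).
  by rewrite ler_wpM2r.
by move: E H1 H2; rewrite mulNr !mulrA; lra.
Qed.

(** Propagation to the right: a bound [C] on [W] bounds [W'] by a multiple of
    [C (t - t0)], and integrating again improves [C] on a short interval. *)
Let profile_eq_right t0 : 0 <= t0 < r -> W t0 = 0 -> 0 <= Z t0 ->
  exists2 e, 0 < e & forall s, t0 <= s < t0 + e -> s < r /\ W s = 0.
Proof.
move=> /andP[t00 t0r] W0 Z0.
pose r1 := (t0 + r) / 2.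
have [t0r1 r1r] : t0 < r1 /\ r1 < r by rewrite /r1; lra.
pose m := U1 r1; have m0 : 0 < m by apply: (profile_gt0 P1); lra.
have Um s : t0 < s < r1 -> m <= U1 s.
  by move=> s01; apply: (profile_nincr P1); lra.
have [M M0 HM] := slope_bounded P1; have [L L0 HL] := ha M.
have [w _ HB] := EVT_max (ltW r_gt0) W_cont.
pose K := c * m `^ (- d) / m.
have K0 : 0 < K by rewrite divr_gt0// mulr_gt0// powR_gt0.
have Zge e C : t0 + e <= r1 -> 0 <= C ->
    (forall s, t0 < s < t0 + e -> W s <= C) ->
    forall y, t0 < y < t0 + e -> - (y ^+ n * (K * C * e)) <= Z y.
  move=> er1 C0 HW y ye; have y0 : 0 <= y by lra.
  have er : t0 + e < r by lra.
  have Um' s : t0 < s < t0 + e -> m <= U1 s by move=> se; apply: Um; lra.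
  apply: le_trans (flow_gap_ge_right t00 er m0 C0 Z0 Um' HW ye).
  have KC0 : 0 <= K * C by exact: mulr_ge0 (ltW K0) C0.
  by rewrite lerN2 ler_wpM2l ?exprn_ge0// ler_wpM2l//; lra.
clearbody K.
have LK0 : 0 < L * K by rewrite mulr_gt0.
(* On an interval of length e a bound C on W improves to L K e^2 C; the summand
   1 in Q also keeps e below 1. *)
pose Q := 1 + L * K.
have Q0 : 0 < Q by rewrite /Q; lra.
have [e [e0 er1 eQ]] : exists e, [/\ 0 < e, e <= r1 - t0 & L * K * e * e <= 2^-1].
  exists (Num.min (r1 - t0) (2 * Q)^-1).
  set e := Num.min _ _.
  have e0 : 0 < e by rewrite lt_min subr_gt0 t0r1 invr_gt0 mulr_gt0.
  split => //; first by rewrite ge_min lexx.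
  have e1 : e <= (2 * Q)^-1 by rewrite ge_min lexx orbT.
  have Qe : Q * e <= 2^-1.
    by rewrite -ler_pdivlMl// -invfM mulrC.
  have LKe0 : 0 < L * K * e by rewrite mulr_gt0.
  clearbody e; move: Qe; rewrite /Q mulrDl mul1r => Qe.
  have e2 : e <= 1 by lra.
  have : L * K * e * e <= L * K * e * 1 by rewrite ler_pM2l.
  lra.
pose I := [set s : R | t0 < s < t0 + e].
have IP s : I s -> W s <= 0.
  apply: (@halving_le0 _ I W (fun=> 1) (`|W w|)) => //.
    move=> x /andP[x0 xe]; rewrite mulr1; apply: le_trans (ler_norm _).
    by apply: HB; rewrite in_itv/=; lra.
  move=> C C0 HC x /andP[x0 xe]; rewrite mulr1.
  have [y /andP[y0 yx] E] := W_mvt t00 x0 ltac:(lra).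
  have yr : 0 < y <= r by lra.
  have KC0 : 0 <= K * C by exact: mulr_ge0 (ltW K0) C0.
  have HW z : t0 < z < t0 + e -> W z <= C by move=> /HC; rewrite mulr1.
  have Zy : - (y ^+ n * (K * C * e)) <= Z y by apply: (Zge e C _ C0 HW); lra.
  have KCe : 0 <= K * C * e by exact: mulr_ge0 KC0 (ltW e0).
  have vv := slope_diff_le HL HM (ltW L0) yr KCe Zy.
  have : (v1 y - v2 y) * (x - t0) <= L * (K * C * e) * e.
    have [vn|vp] := leP (v1 y - v2 y) 0.
      apply: (@le_trans _ _ 0); first by rewrite mulr_le0_ge0// subr_ge0 ltW.
      exact: mulr_ge0 (mulr_ge0 (ltW L0) KCe) (ltW e0).
    by apply: ler_pM => //; [exact: ltW|lra|lra].
  rewrite -E W0 subr0 => /le_trans; apply.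
  have -> : L * (K * C * e) * e = (L * K * e * e) * C by ring.
  by rewrite [leRHS]mulrC ler_wpM2r.
exists e => // s /andP[s0 se]; split; first lra.
move: s0; rewrite le_eqVlt => /predU1P[<-//|s0].
apply/eqP; rewrite eq_le W_ge0 ?andbT; last lra.
by apply: IP; rewrite /I/= s0.
Qed.

(** The slope of [U1] is bounded below near [t0]; at [t0 = r] this is the
    linear growth of [U1] away from the boundary. *)
Let profile_linear_growth t0 : 0 < t0 <= r ->
  exists2 k, 0 < k & forall s, t0 / 2 <= s -> s < t0 -> k * (t0 - s) <= U1 s.
Proof.
move=> /andP[t00 t0r].
have v1c := within_cont_sub (slope_cont P1) (ltW (divr_gt0 t00 (ltr0Sn _ 1))) t0r.
have [m mt Hm] := EVT_min (ltac:(lra) : t0 / 2 <= t0) v1c.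
exists (v1 m).
  by apply: (slope_gt0 P1 h1_ge0); move: mt; rewrite in_itv/=; lra.
move=> s s0 st; have [x /andP[sx xt] E] := mvt_exists st
    (within_cont_sub (profile_cont P1) (ltac:(lra) : 0 <= s) t0r)
    (fun x (xt : s < x < t0) => profile_deriv P1 (t := x) ltac:(lra)).
have kx : v1 m <= v1 x by apply: Hm; rewrite in_itv/=; lra.
have U1t : 0 <= U1 t0.
  by rewrite -(profile_end P1); apply: (profile_nincr P1); lra.
have : v1 m * (t0 - s) <= v1 x * (t0 - s) by rewrite ler_wpM2r//; lra.
lra.
Qed.

(** With [W] at most, and [U1] at least, of order [t0 - z], the quotient
    [W / U1] is bounded and only [U1^(-d)] is singular. *)
Let flow_gap_deriv_ge t0 k C z : 0 < z -> z < t0 -> t0 <= r -> 0 < k -> 0 <= C ->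
  k * (t0 - z) <= U1 z -> W z <= C * (t0 - z) ->
  - (t0 ^+ n * (c * k `^ (- d) / k * C * (t0 - z) `^ (- d))) <= Z' z.
Proof.
move=> z0 zt t0r k0 C0 U1z Wz.
have zr : 0 < z < r by lra.
have tz : 0 < t0 - z by lra.
have Wz0 : 0 <= W z by apply: W_ge0; lra.
have U1z0 : 0 < U1 z by apply: lt_le_trans U1z; rewrite mulr_gt0.
have [z00 zt0 t00] : [/\ 0 <= z, z <= t0 & 0 <= t0] by split; lra.
set B := c * k `^ (- d) / k * C * (t0 - z) `^ (- d).
have B0 : 0 <= B.
  by rewrite !mulr_ge0 ?powR_ge0 ?invr_ge0 ?(ltW c_gt0) ?(ltW k0).
apply: (@le_trans _ _ (- (z ^+ n * B))).
  by rewrite lerN2 ler_wpM2r// lerXn2r ?nnegrE.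
apply: Z'_ge => //.
have H1 : U1 z `^ (- d) <= k `^ (- d) * (t0 - z) `^ (- d).
  rewrite -powRM ?(ltW k0) ?(ltW tz)// !powRN lef_pV2 ?posrE ?powR_gt0//; last by rewrite mulr_gt0.
  by apply: (ge0_ler_powR (ltW d_gt0)); rewrite ?nnegrE ?mulr_ge0 ?(ltW k0) ?(ltW tz) ?(ltW U1z0).
have H2 : W z / U1 z <= C / k.
  rewrite ler_pdivrMr//; apply: le_trans Wz _.
  by rewrite -mulrA ler_wpM2l// ler_pdivlMl.
have -> : B = c * ((k `^ (- d) * (t0 - z) `^ (- d)) * (C / k)).
  by rewrite /B; ring.
rewrite -!mulrA ler_pM2l// [leRHS]mulrA.
by apply: ler_pM; rewrite ?powR_ge0 ?divr_ge0 ?(ltW U1z0).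
Qed.

(** Integrating [(t0 - z)^(-d)] up to the singular end costs no more than a
    factor [1 / (1 - d)]. *)
Let flow_gap_le_left t0 e k C : 0 < t0 <= r -> e <= t0 / 2 -> 0 < k -> 0 <= C ->
  Z t0 <= 0 ->
  (forall s, t0 - e < s < t0 -> k * (t0 - s) <= U1 s) ->
  (forall s, t0 - e < s < t0 -> W s <= C * (t0 - s)) ->
  forall y, t0 - e < y < t0 ->
    Z y <= t0 ^+ n * (c * k `^ (- d) / k) / (1 - d) * C * (t0 - y) `^ (1 - d).
Proof.
move=> /andP[t00 t0r] et0 k0 C0 Z0 HU HW y /andP[y0 ye].
have d_lt := d_lt1; have d1 : 0 < 1 - d by lra.
set A := _ / (1 - d).
have AE : A * (1 - d) = t0 ^+ n * (c * k `^ (- d) / k).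
  by rewrite /A divfK// gt_eqF.
have dZ z : y < z < t0 ->
    - (t0 ^+ n * (c * k `^ (- d) / k * C * (t0 - z) `^ (- d))) <= Z' z.
  move=> yz; have [z0 zt] : 0 < z /\ z < t0 by lra.
  by apply: flow_gap_deriv_ge; [| | | | |apply: HU; lra|apply: HW; lra].
clearbody A.
(* Adding a primitive of the bound on -Z' to Z makes it nondecreasing. *)
pose G s := Z s - A * C * (t0 - s) `^ (1 - d).
pose dG s := Z' s + A * C * (1 - d) * (t0 - s) `^ (- d).
have y00 : 0 <= y by lra.
have Gc : {within `[y, t0], continuous G}.
  apply: within_cont_B; first exact: within_cont_sub Z_cont y00 t0r.
  apply/subspace_continuousP => u /=; rewrite in_itv/= => /andP[yu ut].
  apply: cvgMr.
  have /subspace_continuousP/(_ (t0 - u)) := @powR_within_continuous _ (1 - d) 0 (t0 - y) d1 (lexx _).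
  rewrite /= in_itv/= => /(_ ltac:(lra)) H.
  apply: (cvg_comp (fun s => t0 - s) (fun s => s `^ (1 - d)) _ H).
  move=> B; rewrite /within/= => -[b /= b0 HB].
  exists b => // z /= zs; rewrite in_itv/= => zyt; apply: HB => /=.
    by rewrite /ball_ /= opprB addrC addrA subrK distrC.
  by rewrite in_itv/=; lra.
have dGP u : y < u < t0 -> is_derive u 1 G (dG u).
  move=> /andP[ys st].
  have DZ : is_derive u 1 Z (Z' u) by apply: Z_deriv; lra.
  have tu : 0 < t0 - u by lra.
  have Dp := is_derive1_powR (1 - d) tu.
  have Ds : is_derive u 1 (fun x => t0 - x) (- 1).
    by apply: is_derive_eq (is_deriveB (is_derive_cst t0 u 1) (is_derive_id u 1)) _; rewrite sub0r.
  have Dc := @is_derive1_comp _ (fun x => x `^ (1 - d)) (fun x => t0 - x) u _ _ Dp Ds.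
  have DG := is_deriveB DZ (is_deriveZ (A * C) Dc).
  apply: is_derive_eq DG _.
  rewrite /dG (_ : 1 - d - 1 = - d); last by ring.
  by rewrite /GRing.scale/=; ring.
have [z yzt E] := mvt_exists ye Gc dGP.
have dz : 0 <= dG z.
  rewrite /dG [A * C * _]mulrAC AE.
  by have := dZ z yzt; rewrite !mulrA; lra.
have ty : 0 <= t0 - y by lra.
have := mulr_ge0 dz ty.
rewrite -E /G subrr powR0; last by rewrite subr_eq0 gt_eqF.
by rewrite mulr0 subr0; move: Z0; lra.
Qed.

(** Propagation to the left, including [t0 = r], where it is the boundary point
    lemma. The contraction is run on the ratio of [W s] to [t0 - s]. *)
Let profile_eq_left t0 : 0 < t0 <= r -> W t0 = 0 -> Z t0 <= 0 ->
  exists2 e, 0 < e & forall s, t0 - e < s <= t0 -> 0 < s /\ W s = 0.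
Proof.
move=> t0r' W0 Z0; have d_lt := d_lt1; have /andP[t00 t0r] := t0r'.
have [M M0 HM] := slope_bounded P2; have [L L0 HL] := ha M.
have [k k0 U1ge] := profile_linear_growth t0r'.
have d1 : 0 < 1 - d by lra.
have c0 := c_gt0.
have A0 : 0 < t0 ^+ n * (c * k `^ (- d) / k) / (1 - d).
  by rewrite !mulr_gt0 ?exprn_gt0 ?powR_gt0 ?invr_gt0.
have Zle' e C := @flow_gap_le_left t0 e k C t0r'.
move: (t0 ^+ n * (c * k `^ (- d) / k) / (1 - d)) A0 Zle' => A A0 Zle'.
pose Q := L * (A * (2 / t0) ^+ n).
have Q0 : 0 < Q.
  by rewrite mulr_gt0// mulr_gt0// exprn_gt0// divr_gt0.
have Qi : 0 < (2 * Q)^-1 by rewrite invr_gt0 mulr_gt0.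
(* On an interval of length e a bound C on the ratio improves to Q e^(1-d) C;
   the factor 2 / t0 bounds 1 / s there. *)
have [e1 e10 He1] := powR_cvg_at0 d1 Qi.
pose e := Num.min e1 (t0 / 2).
have e0 : 0 < e by rewrite lt_min e10 divr_gt0.
have ee1 : e <= e1 by rewrite ge_min lexx.
have et0 : e <= t0 / 2 by rewrite ge_min lexx orbT.
clearbody e.
have U1e s : t0 - e < s < t0 -> k * (t0 - s) <= U1 s.
  by move=> /andP[? ?]; apply: U1ge; lra.
pose I := [set s : R | t0 - e < s < t0].
have vle C : 0 <= C -> (forall s, I s -> W s <= C * (t0 - s)) ->
    forall y, I y -> v2 y - v1 y <= C / 2.
  move=> C0 HC y Iy; move: (Iy) => /andP[y0 ye].
  have yr : 0 <= y <= r by lra.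
  have v10 := slope_ge0 P1 yr; have v20 := slope_ge0 P2 yr.
  have [v12|v21] := leP (v2 y) (v1 y).
    by apply: (@le_trans _ _ 0); rewrite ?subr_le0// divr_ge0.
  apply: le_trans (HL _ _ v10 (ltW v21) (HM y yr)) _.
  have yn : 0 < y ^+ n by rewrite exprn_gt0//; lra.
  have -> : a (v2 y) - a (v1 y) = Z y / y ^+ n.
    by rewrite /Z -mulrBr mulrC mulKf// gt_eqF.
  have [y00 yt2] : 0 < y /\ t0 <= 2 * y by lra.
  have [ty ty1] : 0 <= t0 - y /\ t0 - y <= e1 by lra.
  have AC0 : 0 <= A * C by rewrite mulr_ge0// ltW.
  have ZQ : Z y <= A * C * (2 * Q)^-1.
    apply: le_trans (Zle' e C et0 k0 C0 Z0 U1e HC y Iy) _.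
    by rewrite ler_wpM2l// He1.
  have Zn : Z y / y ^+ n <= A * C * (2 * Q)^-1 * (2 / t0) ^+ n.
    apply: (@le_trans _ _ (A * C * (2 * Q)^-1 / y ^+ n)).
      by rewrite ler_wpM2r// invr_ge0 ltW.
    rewrite ler_wpM2l//; first exact: mulr_ge0 AC0 (ltW Qi).
    rewrite -exprVn lerXn2r ?nnegrE ?invr_ge0 ?divr_ge0 ?(ltW t00) ?(ltW y00)//.
    by rewrite -div1r ler_pdivrMr// mulrAC ler_pdivlMr// mul1r.
  apply: le_trans (ler_wpM2l (ltW L0) Zn) _.
  suff -> : L * (A * C * (2 * Q)^-1 * (2 / t0) ^+ n) = C / 2 by [].
  rewrite (_ : L * _ = Q * (2 * Q)^-1 * C); last by rewrite /Q; ring.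
  by field; rewrite gt_eqF.
have IP s : I s -> W s <= 0.
  apply: (@halving_le0 _ I W (fun s => t0 - s) M); first exact: ltW.
    move=> x /andP[x0 xe]; have x00 : 0 <= x by lra.
    have [y /andP[y0 yx] E] := W_mvt x00 xe t0r.
    have yr : 0 <= y <= r by lra.
    have vM : v2 y - v1 y <= M by have := HM y yr; have := slope_ge0 P1 yr; lra.
    have : (v2 y - v1 y) * (t0 - x) <= M * (t0 - x) by rewrite ler_wpM2r//; lra.
    by move: E; rewrite W0; lra.
  move=> C C0 HC x /andP[x0 xe]; have x00 : 0 <= x by lra.
  have [y /andP[y0 yx] E] := W_mvt x00 xe t0r.
  have Iy : I y by rewrite /I/=; lra.
  have : (v2 y - v1 y) * (t0 - x) <= C / 2 * (t0 - x).
    by rewrite ler_wpM2r ?vle//; lra.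
  by move: E; rewrite W0; lra.
exists e => // s /andP[s0]; rewrite le_eqVlt => /predU1P[->//|st]; split; first lra.
apply/eqP; rewrite eq_le W_ge0 ?andbT; last lra.
by apply: IP; rewrite /I/= s0.
Qed.

Let W_eq0_near t0 : 0 <= t0 < r -> W t0 = 0 ->
  exists2 e, 0 < e & forall s, 0 <= s < r -> `|s - t0| < e -> W s = 0.
Proof.
move=> t0r W0.
have Z0 : Z t0 = 0.
  by apply: Z_W_critical => // s sr; rewrite W0; exact: W_ge0.
have [e1 e10 H1] := profile_eq_right t0r W0 ltac:(by rewrite Z0).
have [t00|t00] := leP t0 0.
  exists e1 => // s /andP[s0 sr]; rewrite ltr_norml => /andP[se1 se2].
  by apply: (proj2 (H1 s _)); lra.
have [e2 e20 H2] := profile_eq_left (ltac:(lra) : 0 < t0 <= r) W0 ltac:(by rewrite Z0).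
exists (Num.min e1 e2); first by rewrite lt_min e10.
move=> s /andP[s0 sr]; rewrite ltr_norml !lt_min ltrNl lt_min => /andP[/andP[sa sb] /andP[sc sd]].
have [ts|st] := leP t0 s; first by apply: (proj2 (H1 s _)); lra.
by apply: (proj2 (H2 s _)); lra.
Qed.

(** The zero set of [W] is open by propagation and closed by continuity. *)
Let W_eq0_all t0 : 0 <= t0 < r -> W t0 = 0 -> forall t, 0 <= t < r -> W t = 0.
Proof.
move=> t0r W0 t tr.
pose A : set R := `[0, r[%classic; pose B : set R := [set s | 0 <= s < r /\ W s = 0].
have AE (s : R) : A s = is_true (0 <= s < r) by rewrite /A/= in_itv.
suff BA : B = A by suff [] : B t by []; rewrite BA AE.
have cA : connected A by apply/connected_intervalP; exact: interval_is_interval.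
apply: cA; first by exists t0.
- exists (interior (~` A `|` B)); first exact: open_interior.
  apply/seteqP; split => s.
    move=> [sr Ws]; split; first by rewrite AE.
    have [e e0 He] := W_eq0_near sr Ws.
    exists e => //= x; rewrite /ball_/= distrC => xs.
    have [Ax|] := pselect (A x); last by left.
    by right; move: Ax; rewrite AE => xr; split => //; exact: He.
  by move=> [As /interior_subset[]].
- exists (~` interior (~` A `|` [set s | W s != 0])).
    by apply: open_closedC; exact: open_interior.
  apply/seteqP; split => s.
    move=> [sr Ws]; split; first by rewrite AE.
    by move=> /interior_subset[NA|]; [apply: NA; rewrite AE|rewrite /= Ws eqxx].
  move=> [As Cs]; have sr := As; rewrite AE in sr; split => //; apply/eqP.
  apply: contra_notT Cs => Ws0.
  have NWs : (fun s => - W s) s < 0.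
    by rewrite oppr_lt0 lt_neqAle eq_sym Ws0 W_ge0//; lra.
  have NW_cont : {within `[0, r], continuous (fun s => - W s)}.
    apply/subspace_continuousP => x xr; apply: cvgN.
    by move/subspace_continuousP : W_cont => /(_ x xr).
  have [e e0 He] := within_cont_lt NW_cont (ltac:(rewrite in_itv/=; lra) : s \in `[0, r]) NWs.
  exists e => //= x; rewrite /ball_/= distrC => xs.
  have [Ax|] := pselect (A x); last by left.
  right => /=; move: Ax; rewrite AE => xr.
  by rewrite gt_eqF// -oppr_lt0 He// in_itv/=; lra.
Qed.

Hypothesis h12_neq : ~ (forall t, 0 < t < r -> h1 t = h2 t).

Theorem radial_strong_comparison :
  (forall t, 0 <= t < r -> U1 t < U2 t) /\ 0 < v1 r < v2 r.
Proof.
have rr := r_gt0.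
have Wpos t : 0 <= t < r -> 0 < W t.
  move=> tr; rewrite lt_neqAle W_ge0 ?andbT; last lra.
  apply/eqP => /esym/(W_eq0_all tr) WE; apply: h12_neq => s sr.
  have Z0 x : 0 < x < r -> Z x = 0.
    move=> xr; apply: Z_W_critical; first lra.
    by move=> y yr; rewrite WE ?W_ge0//; lra.
  have Zs : is_derive s 1 Z 0.
    have sin : s \in `]0, r[ by rewrite in_itv.
    apply: (derive1_at_min (ltW r_gt0) _ sin).
      by move=> y; rewrite in_itv/= => /Z_deriv[].
    by move=> y; rewrite in_itv/= => yr; rewrite !Z0.
  have := @derive_val _ _ _ _ _ _ _ (Z_deriv sr).
  rewrite (@derive_val _ _ _ _ _ _ _ Zs) => /esym/eqP.
  have sn : 0 < s ^+ n by rewrite exprn_gt0//; lra.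
  have : W s = 0 by apply: WE; lra.
  move/eqP; rewrite subr_eq0 => /eqP UE.
  by rewrite mulf_eq0 gt_eqF//= UE subrr mulr0 add0r subr_eq0 => /eqP.
split; first by move=> t tr; rewrite -subr_gt0; exact: Wpos.
have v1r : 0 < v1 r by apply: (slope_gt0 P1 h1_ge0); lra.
rewrite v1r/= ltNge; apply/negP => v21.
have v2r : 0 <= v2 r by apply: (slope_ge0 P2); lra.
have Zr : Z r <= 0.
  rewrite /Z -mulrBr mulr_ge0_le0 ?exprn_ge0 ?(ltW r_gt0)// subr_le0 leNgt.
  by apply/negP => /(inverse_lipschitz_lt (ltW v1r) v2r); rewrite ltNge v21.
have [e e0 H] := profile_eq_left (ltac:(lra) : 0 < r <= r) W_end Zr.
pose s := Num.max (r - e / 2) (r / 2).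
have [s1 s2] : s < r /\ r - e < s.
  by split; rewrite /s ?gt_max ?lt_max; [apply/andP; split; lra|apply/orP; left; lra].
have [s0 Ws] := H s ltac:(lra).
by have := Wpos s ltac:(lra); rewrite Ws ltxx.
Qed.

End radial_comparison.

(** * The Euclidean norm and dilations of Lebesgue measure *)

Section euclidean_norm.
Context {R : realType} {N : nat}.
Implicit Types x y : 'rV[R]_N.

Lemma dotp_ge0 x : 0 <= dotp x x.
Proof. by apply: sumr_ge0 => i _; rewrite -expr2 sqr_ge0. Qed.

Lemma enorm_ge0 x : 0 <= enorm x.
Proof. exact: sqrtr_ge0. Qed.

Lemma sqr_enorm x : enorm x ^+ 2 = dotp x x.
Proof. by rewrite sqr_sqrtr// dotp_ge0. Qed.

Lemma dotpZl (a : R) x y : dotp (a *: x) y = a * dotp x y.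
Proof. by rewrite /dotp mulr_sumr; apply: eq_bigr => i _; rewrite mxE mulrA. Qed.

Lemma dotpZr (a : R) x y : dotp x (a *: y) = a * dotp x y.
Proof. by rewrite /dotp mulr_sumr; apply: eq_bigr => i _; rewrite mxE mulrCA. Qed.

Lemma dotpDl x y z : dotp (x + y) z = dotp x z + dotp y z.
Proof. by rewrite /dotp -big_split; apply: eq_bigr => i _; rewrite mxE mulrDl. Qed.

Lemma enormZ (a : R) x : enorm (a *: x) = `|a| * enorm x.
Proof.
by rewrite /enorm dotpZl dotpZr mulrA -expr2 sqrtrM ?sqr_ge0// sqrtr_sqr.
Qed.

Lemma coord_le_enorm x i : `|x 0 i| <= enorm x.
Proof.
rewrite -sqrtr_sqr /enorm ler_wsqrtr// /dotp (bigD1 i)//= -expr2 lerDl.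
by apply: sumr_ge0 => j _; rewrite -expr2 sqr_ge0.
Qed.

Lemma enorm0_eq0 x : enorm x = 0 -> x = 0.
Proof.
move=> x0; apply/rowP => i; rewrite mxE; apply/eqP.
by rewrite -normr_eq0 eq_le normr_ge0 andbT -x0 coord_le_enorm.
Qed.

Lemma enorm0 : enorm (0 : 'rV[R]_N) = 0.
Proof. by rewrite -(scale0r 0) enormZ normr0 mul0r. Qed.

Lemma continuous_dotp : continuous (fun x => dotp x x).
Proof.
have := @continuous_big R 'I_N +%R 0 xpredT (@add_continuous R) 'rV[R]_N
  (index_enum _) (fun i x => x 0 i * x 0 i); apply=> i _ x.
by apply: continuousM; exact: coord_continuous.
Qed.

Lemma continuous_enorm : continuous (@enorm R N).
Proof.
move=> x; apply: (continuous_comp (@continuous_dotp x)).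
exact: sqrt_continuous.
Qed.

Lemma measurable_enorm : measurable_fun setT (@enorm R N : _ -> R).
Proof.
apply: (@measurableT_comp _ _ _ _ _ _ (@Num.sqrt R)) => //.
  by apply: continuous_measurable_fun => ?; exact: sqrt_continuous.
apply: measurable_sum => i.
by apply: measurable_funM; exact: measurable_coord.
Qed.

Lemma measurable_ecball r : measurable (ecball r : set 'rV[R]_N).
Proof.
rewrite (_ : ecball r = setT `&` enorm @^-1` `]-oo, r]).
  by apply: measurable_enorm => //; exact: measurable_itv.
by apply/seteqP; split => x /=; rewrite in_itv/= /ecball/=; [split|case].
Qed.

Lemma closed_ecball r : closed (ecball r : set 'rV[R]_N).
Proof.
rewrite (_ : ecball r = enorm @^-1` [set t | t <= r]); last by [].
apply: preimage_closed => [x _|]; [exact: continuous_enorm|exact: closed_le].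
Qed.

Lemma open_eball r : open (eball r : set 'rV[R]_N).
Proof.
rewrite (_ : eball r = enorm @^-1` [set t | t < r]); last by [].
by apply: open_comp => [x _|]; [exact: continuous_enorm|exact: open_lt].
Qed.

Lemma compact_ecball r : compact (ecball r : set 'rV[R]_N).
Proof.
apply: bounded_closed_compact; last exact: closed_ecball.
exists `|r|; split; first exact: num_real.
move=> M rM x /= xr; have [|x0] := leP `|x| 0.
  by move=> /le_trans; apply; apply: le_trans (ltW rM).
have [|i xi] := @mx_norm_neq0 _ _ _ x; first by rewrite gt_eqF.
have -> : `|x| = `|x 0 i.2| by apply: (etrans xi); rewrite ord1.
 apply: le_trans (coord_le_enorm x _) _.
apply: le_trans xr _; apply: le_trans (ler_norm _) (ltW rM).
Qed.

End euclidean_norm.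

Section axis.
Context {R : realType} {n : nat}.

Definition axis (t : R) : 'rV[R]_n.+1 := t *: evec ord0.

Lemma enorm_evec i : enorm (evec i : 'rV[R]_n.+1) = 1.
Proof.
rewrite /enorm /dotp (bigD1 i)//= big1 => [|j ji].
  by rewrite /evec !mxE !eqxx mulr1 addr0 sqrtr1.
by rewrite /evec !mxE eqxx (negPf ji) mulr0.
Qed.

Lemma enorm_axis t : enorm (axis t) = `|t|.
Proof. by rewrite enormZ enorm_evec mulr1. Qed.

End axis.

Section dilation.
Context {R : realType}.

(** Both sides are measures, so it is enough to look at intervals. *)
Lemma lebesgue_measure_dilation (y : R) (A : set R) : 0 < y -> measurable A ->
  lebesgue_measure ((fun s => y * s) @^-1` A) =
  ((y^-1)%:E * lebesgue_measure (A : set (measurableTypeR R)))%E.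
Proof.
move=> y0 mA; have yi0 : 0 <= y^-1 by rewrite invr_ge0 ltW.
pose g : measurableTypeR R -> measurableTypeR R := fun s => y * s.
have mg : measurable_fun setT g by exact: measurable_funM.
pose m' : {measure set (measurableTypeR R) -> \bar R} :=
  mscale (NngNum (ltW y0)) (pushforward lebesgue_measure g).
have H : lebesgue_measure (A : set (measurableTypeR R)) = m' mg A.
  apply: lebesgue_measure_unique => // _ [[a b] _ <-].
  rewrite /m'/= /mscale/= /pushforward.
  rewrite (_ : _ @^-1` _ = `]a / y, b / y]%classic); last first.
    apply/seteqP; split => s /=; rewrite /g !in_itv/= !ltr_pdivrMr// !ler_pdivlMr//.
      by rewrite mulrC.
    by rewrite mulrC.
  rewrite !lebesgue_measure_itv/= !lte_fin ltr_pM2r ?invr_gt0//.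
  case: ifP => _; last by rewrite mule0.
  by rewrite -!EFinB -EFinM -mulrBl mulrC divfK// gt_eqF.
rewrite H /m'/= /mscale/= /pushforward muleA -EFinM mulVf ?gt_eqF//.
by rewrite mul1e.
Qed.

Lemma measurable_dilation n (y : R) :
  measurable_fun setT (fun x : 'rV[R]_n => y *: x).
Proof.
apply: measurable_fun_rowP => i.
under eq_fun do rewrite mxE.
by apply: measurable_funM => //; exact: measurable_coord.
Qed.

(** By induction on the dimension: the rescaled measure agrees with the product
    measure on rectangles. *)
Lemma lebesgue_rV_dilation n (y : R) (A : set 'rV[R]_n) : 0 < y ->
  measurable A ->
  lebesgue_rV n ((fun x => y *: x) @^-1` A) = ((y ^- n)%:E * lebesgue_rV n A)%E.
Proof.
move=> y0; elim: n A => [|n IH] A mA.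
  rewrite expr0 invr1 mul1e (_ : _ @^-1` A = A)//.
  by apply/funext => x /=; rewrite [x]thinmx0 scaler0.
rewrite /= /lebesgue_rV_succ /pushforward.
pose T := (measurableTypeR R * 'rV[R]_n)%type.
pose g : T -> T := fun p => (y * p.1, y *: p.2).
have mg : measurable_fun setT g.
  apply/measurable_fun_pairP; split.
    exact: (@measurable_funM _ _ _ _ (cst y) fst).
  exact: (measurableT_comp (@measurable_dilation n y) measurable_snd).
have yn0 : 0 < y ^+ n.+1 by rewrite exprn_gt0.
pose m' : {measure set T -> \bar R} := mscale (NngNum (ltW yn0))
  (pushforward (lebesgue_measure \x lebesgue_rV n)%E g).
have H X : measurable X -> (lebesgue_measure \x lebesgue_rV n)%E X = m' mg X.
  apply: product_measure_unique => B C mB mC.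
  rewrite /m'/= /mscale/= /pushforward.
  rewrite (_ : g @^-1` _ =
    ((fun s => y * s) @^-1` B) `*` ((fun x => y *: x) @^-1` C)) //.
  rewrite product_measure1E; first last.
  - by rewrite -[X in measurable X]setTI; exact: measurable_dilation.
  - rewrite -[X in measurable X]setTI.
    exact: (@measurable_funM _ _ _ _ (cst y) id).
  rewrite [X in (_ * (X * _))%E](lebesgue_measure_dilation y0 mB).
  rewrite [X in (_ * (_ * X))%E](IH _ mC) muleACA.
  rewrite -!EFinM exprS -invfM [LHS]muleA -EFinM mulfV ?mul1e//.
  by rewrite gt_eqF// mulr_gt0// exprn_gt0.
have mX : measurable (@rV_cons R n @^-1` A).
  by rewrite -[X in measurable X]setTI; exact: (measurable_funP (@rV_cons R n)).
have := H _ mX; rewrite /m'/= /mscale/= /pushforward => ->.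
rewrite muleA -EFinM mulVf ?gt_eqF// mul1e.
congr (product_measure1 _ _ _); apply/funext => -[s x] /=.
congr A; apply: etrans (scale_row_mx y s%:M x) _.
by rewrite scale_scalar_mx.
Qed.

End dilation.

(** * A smooth function flat at the origin *)

Lemma is_derive_inv (R : realType) (t : R) : t != 0 ->
  is_derive t 1 (fun s : R => s^-1) (- t ^- 2).
Proof.
move=> t0; apply: is_derive_eq (is_deriveV t0 (is_derive_id t 1)) _.
by rewrite [_ *: _]mulr1.
Qed.

Section flat_function.
Context {R : realType}.

(** The chain rule along a line, reduced to the one-variable rule through
    [h |-> f (h *: v + x)]. *)
Lemma is_derive_comp_dir (V : normedModType R) (f : V -> R) (g : R -> R) x v a b :
  is_derive (f x) 1 g a -> is_derive x v f b -> is_derive x v (g \o f) (a * b).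
Proof.
move=> Dg [fd fE]; pose l (h : R) := f (h *: v + x).
have l0 : l 0 = f x by rewrite /l scale0r add0r.
have ld : derivable l 0 1 := (derivable1P f x v).1 fd.
have dirE (k : V -> R) : 'D_1 (fun h : R => k (h *: v + x)) 0 = 'D_v k x.
  rewrite /derive; set g1 := fun h => h^-1 *: _; set g2 := fun h => h^-1 *: _.
  suff -> : g1 = g2 by [].
  apply/funext => h; rewrite /g1 /g2 /=.
  by rewrite addr0 scale0r add0r [_%:A]mulr1.
have Dl : is_derive (0 : R) 1 l b by apply: DeriveDef => //; rewrite dirE.
rewrite -l0 in Dg.
have [Hd He] := is_derive1_comp Dg Dl.
apply: DeriveDef; first exact: ((derivable1P (g \o f) x v).2 Hd).
by rewrite -He -dirE.
Qed.

(** The functions [t^(-k) exp(-1/t)], extended by 0 for [t <= 0]. They are the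
    building blocks of cutoffs because their derivatives are combinations of
    functions of the same kind. *)
Definition flat (k : nat) (t : R) : R :=
  if 0 < t then t^-1 ^+ k * expR (- t^-1) else 0.

Lemma flat_ge0 k t : 0 <= flat k t.
Proof.
rewrite /flat; case: ifPn => // t0.
by rewrite mulr_ge0 ?expR_ge0// exprn_ge0// invr_ge0 ltW.
Qed.

Lemma flat_gt0 k t : 0 < t -> 0 < flat k t.
Proof.
by move=> t0; rewrite /flat t0 mulr_gt0 ?expR_gt0// exprn_gt0// invr_gt0.
Qed.

Lemma flat_le0 k t : t <= 0 -> flat k t = 0.
Proof. by rewrite /flat ltNge => ->. Qed.

(** From [exp s >= s^(k+2) / (k+2)!] at [s = 1/t]. *)
Lemma flat_le_sqr k t : `|flat k t| <= k.+2`!%:R * t ^+ 2.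
Proof.
rewrite ger0_norm ?flat_ge0//; have [t0|t0] := leP t 0.
  by rewrite flat_le0// mulr_ge0// sqr_ge0.
rewrite /flat t0 expRN; set s := t^-1.
have s0 : 0 < s by rewrite invr_gt0.
rewrite ler_pdivrMr ?expR_gt0//.
have := expR_ge1Dxn k.+1 (ltW s0); set F := k.+2`!%:R.
have F0 : 0 < F :> R by rewrite ltr0n fact_gt0.
move=> H; have {}H : s ^+ k.+2 / F <= expR s by lra.
clearbody F.
have E : s ^+ k = F * t ^+ 2 * (s ^+ k.+2 / F).
  rewrite -(addn2 k) exprD; move: (s ^+ k) => P; rewrite /s; field.
  by rewrite !gt_eqF.
by rewrite E ler_wpM2l// mulr_ge0 ?sqr_ge0// ltW.
Qed.

Global Instance is_derive_flat k (t : R) :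
  is_derive t 1 (flat k) (flat k.+2 t - k%:R * flat k.+1 t).
Proof.
have [t0|t0|->] := ltgtP t 0.
- rewrite !flat_le0 ?ltW// mulr0 subr0.
  apply: (@near_eq_is_derive R R R (cst 0)).
  near=> s; rewrite flat_le0//; near: s.
  by exists (- t) => /=; [lra|move=> s /=; rewrite ltr_norml; lra].
- apply: (@near_eq_is_derive R R R (fun s => s^-1 ^+ k * expR (- s^-1))).
    near=> s; rewrite /flat ifT//; near: s.
    by exists t => //= s /=; rewrite ltr_norml; lra.
  have tn : t != 0 by rewrite gt_eqF.
  have Di := is_derive_inv tn.
  have De := @is_derive1_comp R expR (fun s : R => - s^-1) t _ _ (is_derive_expR _) (is_deriveN Di).
  have Dx := is_deriveX k Di; rewrite exprfctE in Dx.
  apply: is_derive_eq (is_deriveM Dx De) _.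
  rewrite /flat t0 /GRing.scale/=; case: k Dx => [|k] _ /=.
    rewrite !expr0; field.
    by [].
  rewrite !exprS. move: (t^-1 ^+ k) => P. rewrite -mulr_natl. field.
  by [].
- have E : (fun h : R => h^-1 *: ((flat k \o shift 0) (h *: 1) - flat k 0)) @ 0^' --> (0 : R).
    apply/cvgrPdist_le => e e0.
    have F0 : 0 < k.+2`!%:R :> R by rewrite ltr0n fact_gt0.
    exists (e / k.+2`!%:R) => /=; first exact: divr_gt0.
    move=> h /=; rewrite sub0r normrN => he h0.
    rewrite sub0r normrN addr0 [_ *: 1]mulr1 (@flat_le0 k 0)// subr0 normrZ normfV.
    rewrite ler_pdivrMl ?normr_gt0//; apply: le_trans (flat_le_sqr k h) _.
    rewrite -[h ^+ 2]real_normK ?num_real// expr2 mulrCA ler_wpM2l//.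
    by rewrite mulrC -ler_pdivlMr// ltW.
  rewrite !flat_le0// mulr0 subr0.
  apply: DeriveDef; first by apply/cvg_ex; exists 0.
  exact: cvg_lim E.
Unshelve. all: by end_near.
Qed.
End flat_function.

(** * Radial test functions *)

Section smooth_expressions.
Context {R : realType} {N : nat}.
Implicit Types f g : 'rV[R]_N -> R.

(** Smoothness asks for all iterated partial derivatives at once. It is proved
    for a class of expressions that is stable under partial derivatives and
    contains the cutoffs of [|x|^2]. *)
Inductive smooth_expr : ('rV[R]_N -> R) -> Prop :=
| smooth_expr_cst c : smooth_expr (fun=> c)
| smooth_expr_coord i : smooth_expr (fun x => x 0 i)
| smooth_exprD f g : smooth_expr f -> smooth_expr g ->
    smooth_expr (fun x => f x + g x)
| smooth_exprM f g : smooth_expr f -> smooth_expr g ->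
    smooth_expr (fun x => f x * g x)
| smooth_exprV f : (forall x, f x != 0) -> smooth_expr f ->
    smooth_expr (fun x => (f x)^-1)
| smooth_expr_flat k f : smooth_expr f -> smooth_expr (fun x => flat k (f x)).

Lemma is_derive_coord (x : 'rV[R]_N) i j :
  is_derive x (evec j) (fun x : 'rV[R]_N => x 0 i) ((i == j)%:R).
Proof.
have E : (fun h : R =>
    h^-1 *: (((fun x : 'rV[R]_N => x 0 i) \o shift x) (h *: evec j) - x 0 i)) @ 0^'
    --> ((i == j)%:R : R).
  apply/cvgrPdist_le => e e0; near=> h => /=.
  have h0 : h != 0 by near: h; exact: nbhs_dnbhs_neq.
  rewrite !mxE eqxx/= addrK [_ *: (_ * _)]mulKf// subrr normr0.
  exact: ltW.
apply: DeriveDef; first by apply/cvg_ex; exists ((i == j)%:R).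
exact: cvg_lim E.
Unshelve. all: by end_near. Qed.

Lemma continuous_flat k : continuous (@flat R k).
Proof.
move=> t; apply/differentiable_continuous/derivable1_diffP.
by case: (is_derive_flat k t).
Qed.

Lemma smooth_expr_continuous f : smooth_expr f -> continuous f.
Proof.
elim=> {f} [c x|i x|f g _ cf _ cg x|f g _ cf _ cg x|f f0 _ cf x|k f _ cf x].
- exact: cst_continuous.
- exact: coord_continuous.
- by apply: continuousD; [exact: cf|exact: cg].
- by apply: continuousM; [exact: cf|exact: cg].
- by apply: continuousV; [exact: f0|exact: cf].
- apply: (continuous_comp (cf x)); exact: continuous_flat.
Qed.

Lemma smooth_expr_derive f i : smooth_expr f ->
  exists2 g, smooth_expr g & forall x, is_derive x (evec i) f (g x).
Proof.
elim=> {f} [c|j|f g sf [f' sf' df] sg [g' sg' dg]|f g sf [f' sf' df] sg [g' sg' dg]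
  |f f0 sf [f' sf' df]|k f sf [f' sf' df]].
- by exists (fun=> 0); [exact: smooth_expr_cst|move=> x; exact: is_derive_cst].
- exists (fun=> (j == i)%:R); first exact: smooth_expr_cst.
  by move=> x; exact: is_derive_coord.
- exists (fun x => f' x + g' x); first exact: smooth_exprD.
  by move=> x; exact: is_deriveD (df x) (dg x).
- exists (fun x => f x * g' x + g x * f' x).
    by apply: smooth_exprD; exact: smooth_exprM.
  by move=> x; exact: is_deriveM (df x) (dg x).
- exists (fun x => (-1 * ((f x)^-1 * (f x)^-1)) * f' x).
    apply: smooth_exprM => //; apply: smooth_exprM; first exact: smooth_expr_cst.
    by apply: smooth_exprM; exact: smooth_exprV.
  move=> x; have D : is_derive (f x) 1 (fun y : R => y^-1) (-1 * ((f x)^-1 * (f x)^-1)).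
    apply: is_derive_eq (is_deriveV (f0 x) (is_derive_id (f x) 1)) _.
    by rewrite [_ *: _]mulr1 mulN1r expr2 invfM.
  exact: is_derive_comp_dir D (df x).
- exists (fun x => (flat k.+2 (f x) + - k%:R * flat k.+1 (f x)) * f' x).
    apply: smooth_exprM => //; apply: smooth_exprD; first exact: smooth_expr_flat.
    by apply: smooth_exprM; [exact: smooth_expr_cst|exact: smooth_expr_flat].
  move=> x; rewrite mulNr.
  exact: is_derive_comp_dir (is_derive_flat k (f x)) (df x).
Qed.

Lemma smooth_expr_smooth f : smooth_expr f -> smooth f.
Proof.
move=> sf s; have : smooth_expr (partials s f).
  elim: s => //= i s IH; have [g sg dg] := smooth_expr_derive i IH.
  rewrite (_ : 'D_(evec i) (partials s f) = g)//.
  by apply/funext => x; have := dg x => -[].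
move=> sp; split; first exact: smooth_expr_continuous.
by move=> i x; have [g _ dg] := smooth_expr_derive i sp; case: (dg x).
Qed.

Lemma smooth_expr_dotp : smooth_expr (fun x => dotp x x).
Proof.
rewrite /dotp; elim: (index_enum _) => [|i s IH].
  rewrite (_ : (fun x => _) = (fun=> 0)); first exact: smooth_expr_cst.
  by apply/funext => x; rewrite big_nil.
rewrite (_ : (fun x => _) =
  (fun x : 'rV[R]_N => x 0 i * x 0 i + \sum_(j <- s) x 0 j * x 0 j)).
  by apply: smooth_exprD => //; apply: smooth_exprM; exact: smooth_expr_coord.
by apply/funext => x; rewrite big_cons.
Qed.

Lemma is_derive_dotp (x : 'rV[R]_N) i :
  is_derive x (evec i) (fun x : 'rV[R]_N => dotp x x) (2 * x 0 i).
Proof.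
have -> : (fun x : 'rV[R]_N => dotp x x) = \sum_(j < N) (fun x : 'rV[R]_N => x 0 j * x 0 j).
  by apply/funext => y; rewrite fct_sumE.
apply: is_derive_eq (is_derive_sum
  (fun j => is_deriveM (is_derive_coord x j i) (is_derive_coord x j i))) _.
rewrite (bigD1 i)//= big1 => [|j ji].
  by rewrite eqxx addr0 /GRing.scale/= mulr1 mulr2n mulrDl mul1r.
by rewrite (negPf ji) scaler0 addr0.
Qed.

End smooth_expressions.

Section cutoff.
Context {R : realType}.
Variables (a b : R).
Hypothesis ab : a < b.

(** A smooth nonincreasing function, equal to 1 up to [a] and to 0 from [b] on. *)
Definition cutoff (t : R) : R :=
  flat 0 (b - t) / (flat 0 (b - t) + flat 0 (t - a)).

(** The opposite of the derivative of [cutoff], hence nonnegative. *)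
Definition cutoff_slope (t : R) : R :=
  (flat 2 (b - t) * flat 0 (t - a) + flat 0 (b - t) * flat 2 (t - a)) /
  (flat 0 (b - t) + flat 0 (t - a)) ^+ 2.

Lemma cutoff_den_gt0 t : 0 < flat 0 (b - t) + flat 0 (t - a).
Proof.
have [tb|tb] := ltP t b.
  by rewrite ltr_pwDl ?flat_ge0// flat_gt0// subr_gt0.
by rewrite ltr_wpDl ?flat_ge0// flat_gt0// subr_gt0; apply: lt_le_trans tb.
Qed.

Lemma cutoff_ge0 t : 0 <= cutoff t.
Proof. by rewrite divr_ge0 ?flat_ge0// ltW// cutoff_den_gt0. Qed.

Lemma cutoff_le1 t : cutoff t <= 1.
Proof. by rewrite ler_pdivrMr ?cutoff_den_gt0// mul1r lerDl flat_ge0. Qed.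

Lemma cutoff_eq1 t : t <= a -> cutoff t = 1.
Proof.
move=> ta; rewrite /cutoff (@flat_le0 _ _ (t - a)) ?subr_le0// addr0 divff//.
by rewrite gt_eqF// flat_gt0// subr_gt0; apply: le_lt_trans ab.
Qed.

Lemma cutoff_eq0 t : b <= t -> cutoff t = 0.
Proof. by move=> bt; rewrite /cutoff flat_le0 ?subr_le0// mul0r. Qed.

Lemma cutoff_slope_ge0 t : 0 <= cutoff_slope t.
Proof.
by rewrite divr_ge0 ?sqr_ge0// addr_ge0// mulr_ge0// flat_ge0.
Qed.

Lemma cutoff_slope_out t : t <= a \/ b <= t -> cutoff_slope t = 0.
Proof.
case=> h; rewrite /cutoff_slope.
  by rewrite !(@flat_le0 _ _ (t - a)) ?subr_le0// !mulr0 addr0 mul0r.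
by rewrite !(@flat_le0 _ _ (b - t)) ?subr_le0// !mul0r addr0 mul0r.
Qed.

Lemma is_derive_cutoff (t : R) : is_derive t 1 cutoff (- cutoff_slope t).
Proof.
have D0 := cutoff_den_gt0 t.
have D1 : is_derive t 1 (fun s => flat 0 (b - s)) (- flat 2 (b - t)).
  have Db : is_derive t 1 (fun s => b - s) (- 1).
    by apply: is_derive_eq (is_deriveB (is_derive_cst b t 1) (is_derive_id t 1)) _; rewrite sub0r.
  apply: is_derive_eq (@is_derive1_comp R (flat 0) (fun s => b - s) t _ _
    (is_derive_flat 0 (b - t)) Db) _.
  by rewrite mul0r subr0 mulrN1.
have D2 : is_derive t 1 (fun s => flat 0 (s - a)) (flat 2 (t - a)).
  have Da : is_derive t 1 (fun s => s - a) 1.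
    by apply: is_derive_eq (is_deriveB (is_derive_id t 1) (is_derive_cst a t 1)) _; rewrite subr0.
  apply: is_derive_eq (@is_derive1_comp R (flat 0) (fun s => s - a) t _ _
    (is_derive_flat 0 (t - a)) Da) _.
  by rewrite mul0r subr0 mulr1.
have Dn : flat 0 (b - t) + flat 0 (t - a) != 0 by rewrite gt_eqF.
have DV := @is_deriveV R (fun s => flat 0 (b - s) + flat 0 (s - a)) t _ 1
  Dn (is_deriveD D1 D2).
apply: is_derive_eq (is_deriveM D1 DV) _.
rewrite /cutoff_slope /GRing.scale/=.
by field; rewrite Dn.
Qed.

Lemma continuous_cutoff : continuous cutoff.
Proof.
move=> t; apply/differentiable_continuous/derivable1_diffP.
by case: (is_derive_cutoff t).
Qed.

Lemma continuous_cutoff_slope : continuous cutoff_slope.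
Proof.
have cB k : continuous (fun t => flat k (b - t)).
  move=> t; apply: (@continuous_comp _ _ _ (fun t => b - t)); last exact: continuous_flat.
  by apply: cvgB; [exact: cvg_cst|exact: cvg_id].
have cA k : continuous (fun t => flat k (t - a)).
  move=> t; apply: (@continuous_comp _ _ _ (fun t => t - a)); last exact: continuous_flat.
  by apply: cvgB; [exact: cvg_id|exact: cvg_cst].
move=> t; apply: cvgM.
  by apply: cvgD; apply: cvgM; (exact: cA || exact: cB).
apply: cvgV; first by rewrite expf_neq0// gt_eqF// cutoff_den_gt0.
by apply: cvgM; apply: cvgD; (exact: cA || exact: cB).
Qed.

Lemma cutoff_slope_bounded : exists2 M, 0 < M & forall t, cutoff_slope t <= M.
Proof.
have c : {within `[a, b], continuous cutoff_slope}.
  exact: continuous_subspaceT continuous_cutoff_slope.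
have [m _ H] := EVT_max (ltW ab) c.
exists (cutoff_slope m + 1); first by have := cutoff_slope_ge0 m; lra.
move=> t; have m0 := cutoff_slope_ge0 m.
have [ta|ta] := leP t a; first by rewrite cutoff_slope_out; [lra|left].
have [bt|tb] := leP b t; first by rewrite cutoff_slope_out; [lra|right].
have : cutoff_slope t <= cutoff_slope m by apply: H; rewrite in_itv/= !ltW.
lra.
Qed.

Lemma grad_cutoff N (x : 'rV[R]_N) :
  grad (fun x => cutoff (dotp x x)) x = (- (2 * cutoff_slope (dotp x x))) *: x.
Proof.
apply/rowP => i; rewrite !mxE.
have [_ E] := @is_derive_comp_dir _ _ (fun x => dotp x x) _ x _ _ _
  (is_derive_cutoff (dotp x x)) (is_derive_dotp x i).
by apply: etrans E _; ring.
Qed.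

Lemma test_function_cutoff N (r : R) : 0 <= b -> 0 < r -> b < r ^+ 2 ->
  test_function (eball r) (fun x : 'rV[R]_N => cutoff (dotp x x)).
Proof.
move=> b0 r0 br.
have sub : closure [set x : 'rV[R]_N | cutoff (dotp x x) != 0] `<=` ecball (Num.sqrt b).
  have /closure_id -> := @closed_ecball R N (Num.sqrt b).
  apply: closure_subset => x /= xn.
  rewrite /ecball/= /enorm ler_wsqrtr// leNgt; apply: contra xn => /ltW bx.
  by rewrite cutoff_eq0.
split.
- apply: smooth_expr_smooth; rewrite /cutoff.
  have s1 : smooth_expr (fun x : 'rV[R]_N => flat 0 (b - dotp x x)).
    apply: smooth_expr_flat; rewrite (_ : (fun x => _) = (fun x : 'rV[R]_N => b + -1 * dotp x x)).
      apply: smooth_exprD; first exact: smooth_expr_cst.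
      by apply: smooth_exprM; [exact: smooth_expr_cst|exact: smooth_expr_dotp].
    by apply/funext => x; rewrite mulN1r.
  have s2 : smooth_expr (fun x : 'rV[R]_N => flat 0 (dotp x x - a)).
    apply: smooth_expr_flat; apply: smooth_exprD; first exact: smooth_expr_dotp.
    exact: smooth_expr_cst.
  apply: smooth_exprM => //; apply: smooth_exprV; last exact: smooth_exprD.
  by move=> x; rewrite gt_eqF// cutoff_den_gt0.
- exact: subclosed_compact (@closed_closure _ _)
    (@compact_ecball R N (Num.sqrt b)) sub.
- move=> x /sub; rewrite /ecball/eball/= => /le_lt_trans; apply.
  by rewrite -(ger0_norm (ltW r0)) -sqrtr_sqr ltr_sqrt// (le_lt_trans b0).
Qed.

End cutoff.

(** * Integrals of radial functions *)

Section radial_integration.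
Context {R : realType} {N : nat}.
Local Notation mu := (@lebesgue_rV R N).

(** Change of variables for dilations, from the pushforward measure. *)
Lemma ge0_integral_dilation (y : R) (f : 'rV[R]_N -> \bar R) : 0 < y ->
  measurable_fun setT f -> (forall x, 0 <= f x)%E ->
  (\int[mu]_x f (y *: x) = (y ^- N)%:E * \int[mu]_x f x)%E.
Proof.
move=> y0 mf f0.
have yN0 : 0 < y ^- N by rewrite invr_gt0 exprn_gt0.
have md := @measurable_dilation R N y.
have -> : (\int[mu]_x f (y *: x) =
    \int[pushforward mu (fun x => y *: x)]_x f x)%E.
  by rewrite ge0_integral_pushforward.
rewrite -(@ge0_integral_mscale _ _ _ mu setT measurableT (NngNum (ltW yN0)))//.
by apply: eq_measure_integral => A mA _; exact: lebesgue_rV_dilation.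
Qed.

Lemma lebesgue_rV_ecball_scale (t : R) : 0 < t ->
  mu (ecball t) = ((t ^+ N)%:E * mu (ecball 1%R))%E.
Proof.
move=> t0; have ti0 : 0 < t^-1 by rewrite invr_gt0.
rewrite -[ecball t](_ : (fun x => t^-1 *: x) @^-1` ecball 1%R = _).
  rewrite (lebesgue_rV_dilation ti0 (measurable_ecball 1%R)).
  by rewrite exprVn invrK.
apply/seteqP; split => x; rewrite /ecball/= enormZ gtr0_norm//;
  by rewrite mulrC ler_pdivrMr ?mul1r.
Qed.

Lemma lebesgue_rV_cube (t : R) : 0 <= t ->
  mu [set x | forall i, x 0 i \in `[- t, t]] = ((2 * t) ^+ N)%:E.
Proof.
move=> t0; rewrite (lebesgue_rV_box (fun _ : 'I_N => _)) => [|i]; last lra.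
by congr EFin; rewrite prodr_const card_ord; congr (_ ^+ _); ring.
Qed.

Lemma measurable_cube (t : R) :
  measurable [set x : 'rV[R]_N | forall i, x 0 i \in `[- t, t]].
Proof.
rewrite (_ : mkset _ = \bigcap_(i in [set: 'I_N]) ((fun x : 'rV[R]_N => x 0 i) @^-1`
      `[- t, t])); last first.
  by apply/seteqP; split => x /= tx i; [move=> _; exact: tx|exact: tx].
apply: fin_bigcap_measurable => // i _.
by rewrite -[X in measurable X]setTI; exact: measurable_coord.
Qed.

Lemma unit_ball_volume_fin : (mu (ecball 1%R) < +oo)%E.
Proof.
apply: (@le_lt_trans _ _ ((2 * 1) ^+ N)%:E); last exact: ltry.
rewrite -(lebesgue_rV_cube ler01); apply: le_measure.
- by rewrite inE; exact: measurable_ecball.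
- by rewrite inE; exact: measurable_cube.
move=> x; rewrite /ecball/= => x1 i; rewrite in_itv/= -ler_norml.
exact: le_trans (coord_le_enorm x i) x1.
Qed.

(** The ball contains the cube of half-side [1 / (N + 1)]. *)
Lemma unit_ball_volume_gt0 : (0 < mu (ecball 1%R))%E.
Proof.
pose t : R := N.+1%:R^-1; have t0 : 0 < t by rewrite invr_gt0.
apply: (@lt_le_trans _ _ ((2 * t) ^+ N)%:E); first by rewrite lte_fin exprn_gt0// mulr_gt0.
rewrite -(lebesgue_rV_cube (ltW t0)); apply: le_measure.
- by rewrite inE; exact: measurable_cube.
- by rewrite inE; exact: measurable_ecball.
move=> x /= xt; rewrite /ecball/= -(sqrtr1 R) /enorm ler_wsqrtr//.
apply: (@le_trans _ _ (\sum_(i < N) t)).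
  apply: ler_sum => i _; have := xt i; rewrite in_itv/= -ler_norml => xi.
  rewrite -expr2 -[x 0 i ^+ 2]real_normK ?num_real// expr2 -[leRHS]mul1r.
  apply: ler_pM => //; apply: le_trans xi _.
  by rewrite invf_le1// ler1n.
rewrite sumr_const card_ord -mulr_natl ler_pdivrMr// mul1r ler_nat//.
Qed.

Definition unit_ball_volume : R := fine (mu (ecball 1%R)).

Lemma unit_ball_volumeE : mu (ecball 1%R) = unit_ball_volume%:E.
Proof. by rewrite fineK// ge0_fin_numE ?unit_ball_volume_fin. Qed.

Lemma unit_ball_volume_pos : 0 < unit_ball_volume.
Proof. by rewrite -lte_fin -unit_ball_volumeE; exact: unit_ball_volume_gt0. Qed.

Lemma lebesgue_rV_ecball (t : R) : 0 < t ->
  mu (ecball t) = (t ^+ N * unit_ball_volume)%:E.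
Proof. by move=> t0; rewrite lebesgue_rV_ecball_scale// unit_ball_volumeE. Qed.

Lemma integrable_indic_ecball (t : R) : 0 < t ->
  mu.-integrable setT (fun x => (\1_(ecball t) x)%:E).
Proof.
move=> t0; have mt := @measurable_ecball R N t.
apply/integrableP; split; first exact/measurable_EFinP.
under eq_integral do rewrite gee0_abs ?lee_fin//.
by rewrite integral_indic// setIT [X in (X < _)%E]lebesgue_rV_ecball ?ltry.
Qed.

Lemma measurable_radial (k : R -> R) : continuous k ->
  measurable_fun setT (fun x : 'rV[R]_N => k (dotp x x)).
Proof.
move=> ck; apply: (@measurableT_comp _ _ _ _ _ _ k).
  exact: measurable_realfun.continuous_measurable_fun.
apply: measurable_sum => i.
by apply: measurable_funM; exact: measurable_coord.
Qed.

Lemma integrable_radial (k : R -> R) (M b : R) : continuous k -> 0 < b ->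
  (forall t, 0 <= k t <= M) -> (forall t, b <= t -> k t = 0) ->
  mu.-integrable setT (fun x => (k (dotp x x))%:E).
Proof.
move=> ck b0 kM kb.
have M0 : 0 <= M by case/andP: (kM 0) => /le_trans; apply.
have mG : measurable (ecball (Num.sqrt b) : set 'rV[R]_N) by exact: measurable_ecball.
apply: (@le_integrable _ _ _ _ _ measurableT _
   (fun x => (M * \1_(ecball (Num.sqrt b)) x)%:E)).
- by apply/measurable_EFinP; exact: (measurable_radial ck).
- move=> x _; rewrite lee_fin [leRHS]ger0_norm ?mulr_ge0//.
  rewrite ger0_norm; last by case/andP: (kM (dotp x x)).
  rewrite indicE; case: (boolP (x \in _)) => [_|].
    by rewrite mulr1; case/andP: (kM (dotp x x)).
  rewrite notin_setE /ecball/= => /negP; rewrite -ltNge => bx.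
  rewrite kb ?mulr0// -(@ler_sqrt _ b) ?dotp_ge0//.
  exact: ltW.
- under eq_fun do rewrite EFinM.
  by apply: integrableZl => //; apply: integrable_indic_ecball; rewrite sqrtr_gt0.
Qed.

Variables (a b : R).
Hypotheses (a_ge0 : 0 <= a) (ab : a < b).

Let b_gt0 : 0 < b. Proof. exact: le_lt_trans ab. Qed.

Lemma integrable_cutoff : mu.-integrable setT (fun x => (cutoff a b (dotp x x))%:E).
Proof.
apply: (integrable_radial (continuous_cutoff ab) b_gt0 (M := 1)) => t.
  by rewrite cutoff_ge0//= cutoff_le1.
exact: cutoff_eq0.
Qed.

Lemma integrable_cutoff_slope :
  mu.-integrable setT (fun x => (2 * cutoff_slope a b (dotp x x) * dotp x x)%:E).
Proof.
have [M M0 HM] := cutoff_slope_bounded ab.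
apply: (integrable_radial (k := fun t => 2 * cutoff_slope a b t * t) (b := b) (M := 2 * M * b)) => //.
- move=> t; apply: cvgM; last exact: cvg_id.
  by apply: cvgMr; exact: continuous_cutoff_slope.
- move=> t; have s0 := cutoff_slope_ge0 a b t; have sM := HM t.
  have [ta|ta] := leP t a.
    rewrite cutoff_slope_out; last by left.
    by rewrite mulr0 mul0r lexx !mulr_ge0// ltW.
  have t0 : 0 <= t := ltW (le_lt_trans a_ge0 ta).
  have [bt|tb] := leP b t.
    rewrite cutoff_slope_out; last by right.
    by rewrite mulr0 mul0r lexx !mulr_ge0// ltW.
  have s20 : 0 <= 2 * cutoff_slope a b t by apply: mulr_ge0.
  by rewrite mulr_ge0//= ler_pM// ?ler_pM2l// ltW.
- by move=> t bt; rewrite cutoff_slope_out ?mulr0 ?mul0r//; right.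
Qed.

Lemma integral_cutoff_dilation (y : R) : 0 < y ->
  \int[mu]_x cutoff a b (y ^+ 2 * dotp x x) = y ^- N * \int[mu]_x cutoff a b (dotp x x).
Proof.
move=> y0; have /= E := @ge0_integral_dilation y (fun x => (cutoff a b (dotp x x))%:E) y0.
rewrite /Rintegral -[y ^- N]/(fine (y ^- N)%:E) -fineM//; last first.
  by apply: integrable_fin_num => //; exact: integrable_cutoff.
rewrite -E.
- congr fine; apply: eq_integral => x _.
  by rewrite dotpZl dotpZr mulrA -expr2.
- by apply/measurable_EFinP; exact: (measurable_radial (continuous_cutoff ab)).
- by move=> x; rewrite lee_fin cutoff_ge0.
Qed.

Lemma is_derive_cutoff_dilation (s y : R) :
  is_derive y 1 (fun y => cutoff a b (y ^+ 2 * s)) (- cutoff_slope a b (y ^+ 2 * s) * (2 * y * s)).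
Proof.
have D : is_derive y 1 (fun y : R => y ^+ 2 * s) (2 * y * s).
  have D1 := is_deriveM (is_derive_id y 1) (is_deriveM (is_derive_id y 1) (is_derive_cst s y 1)).
  rewrite (_ : (fun y : R => y ^+ 2 * s) = id * (id * cst s)); last first.
    by apply/funext => z; rewrite expr2 -mulrA.
  by apply: is_derive_eq D1 _; rewrite !fctE /GRing.scale/=; ring.
exact: @is_derive1_comp R (cutoff a b) (fun y => y ^+ 2 * s) y _ _ (is_derive_cutoff ab _) D.
Qed.

(** The divergence theorem for the field [psi(|x|^2) x], obtained without
    integration by parts: differentiate at [y = 1] both expressions of the
    integral of [psi(|y x|^2)], as an integral depending on the parameter [y] and
    as [y^(-N)] times the integral of [psi(|x|^2)]. *)
Lemma integral_cutoff_slope :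
  \int[mu]_x (2 * cutoff_slope a b (dotp x x) * dotp x x) =
  N%:R * \int[mu]_x cutoff a b (dotp x x).
Proof.
have b0 := b_gt0.
pose f (y : R) (x : 'rV[R]_N) := cutoff a b (y ^+ 2 * dotp x x).
pose F y := \int[mu]_x f y x.
have FE y : 0 < y -> F y = y ^- N * F 1.
  move=> y0; rewrite /F /f integral_cutoff_dilation//; congr (_ * _).
  by apply: eq_Rintegral => x _; rewrite expr1n mul1r.
have d1E y x : derive1 (f ^~ x) y = - cutoff_slope a b (y ^+ 2 * dotp x x) * (2 * y * dotp x x).
  by rewrite derive1E; case: (is_derive_cutoff_dilation (dotp x x) y).
have [M M0 HM] := cutoff_slope_bounded ab.
(* For 1/2 < y < 2 the integrand lives where |x|^2 <= 4 b, and the derivative in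
   y is at most M * (2 * 2 * 4 b) there. *)
pose G (x : 'rV[R]_N) := M * (16 * b) * \1_(ecball (Num.sqrt (4 * b))) x.
have b4 : 0 < 4 * b by lra.
have dF : derive1 F 1 = \int[mu]_x derive1 (f ^~ x) 1.
  apply: (@differentiation_under_integral R _ _ mu f setT measurableT 1 2^-1 2 _ _ _ G).
  - by rewrite /= in_itv/=; lra.
  - move=> y; rewrite /= in_itv/= => /andP[y1 y2].
    have y20 : 0 < y ^+ 2 by rewrite exprn_gt0//; lra.
    apply: (integrable_radial (k := fun t => cutoff a b (y ^+ 2 * t)) (b := b / y ^+ 2) (M := 1)).
    + move=> t; apply: (@continuous_comp _ _ _ (fun t => y ^+ 2 * t)); last exact: continuous_cutoff.
      by apply: cvgMr; exact: cvg_id.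
    + exact: divr_gt0.
    + by move=> t; rewrite cutoff_ge0//= cutoff_le1.
    + by move=> t bt; rewrite cutoff_eq0// mulrC -ler_pdivrMr.
  - by move=> y x _ _; case: (is_derive_cutoff_dilation (dotp x x) y).
  - by move=> x; rewrite !mulr_ge0//; lra.
  - rewrite /G /comp; under eq_fun do rewrite EFinM.
    apply: integrableZl => //; apply: integrable_indic_ecball.
    by rewrite sqrtr_gt0.
  - move=> y x; rewrite /= in_itv/= => /andP[y1 y2] _.
    rewrite /partial1of2 d1E; set t := dotp x x; have t0 : 0 <= t := dotp_ge0 x.
    have s0 := cutoff_slope_ge0 a b (y ^+ 2 * t); have sM := HM (y ^+ 2 * t).
    have yy : 2^-1 * 2^-1 <= y ^+ 2 by rewrite expr2 ler_pM//; lra.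
    have y0 : 0 <= y by lra.
    have y22 : y <= 2 by lra.
    rewrite mulNr normrN ger0_norm; last by rewrite (mulr_ge0 s0)// !mulr_ge0.
    rewrite /G indicE; case: (boolP (x \in _)) => [|].
      rewrite inE /ecball/= /enorm ler_sqrt ?(ltW b4)// -/t => tb.
      rewrite mulr1; apply: ler_pM => //; first by rewrite !mulr_ge0.
      have -> : 16 * b = 2 * 2 * (4 * b) by ring.
      by apply: ler_pM => //; [rewrite mulr_ge0|rewrite ler_pM2l].
    rewrite notin_setE /ecball/= /enorm => /negP; rewrite ler_sqrt ?(ltW b4)// -ltNge -/t => bt.
    rewrite cutoff_slope_out; last first.
      right; apply: (@le_trans _ _ (2^-1 * 2^-1 * t)); first lra.
      by rewrite ler_wpM2r.
    by rewrite mul0r mulr0.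
have D1 : is_derive (1 : R) 1 F (- (N%:R * F 1)).
  apply: (@near_eq_is_derive R R R (fun y => (y^-1 ^+ N) * F 1)).
    near=> y; rewrite [RHS]FE ?exprVn//; near: y.
    by exists 1 => //= y /=; rewrite ltr_norml; lra.
  have n1 : (1 : R) != 0 by [].
  have Di := is_derive_inv n1.
  have Dx := is_deriveX N Di; rewrite exprfctE in Dx.
  have Dc : is_derive (1 : R) 1 (fun _ : R => F 1) 0 by exact: is_derive_cst.
  have DM := is_deriveM Dx Dc.
  apply: is_derive_eq DM _.
  by rewrite /GRing.scale/= !(invr1, expr1n); ring.
move: dF; rewrite derive1E (@derive_val _ _ _ _ _ _ _ D1) => /(congr1 (fun z => - z)).
rewrite opprK => EF; have F1 : F 1 = \int[mu]_x cutoff a b (dotp x x).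
  by apply: eq_Rintegral => x _; rewrite /f expr1n mul1r.
rewrite -F1 EF -[LHS]opprK; congr (- _).
rewrite -mulN1r -RintegralZl//; last exact: integrable_cutoff_slope.
by apply: eq_Rintegral => x _; rewrite d1E expr1n mul1r; ring.
Unshelve. all: by end_near.
Qed.

End radial_integration.

(** * Differential calculus of radial solutions *)

Section radial_calculus.
Context {R : realType} {n : nat}.
Variables (alpha r : R) (u : 'rV[R]_n.+1 -> R).
Hypotheses (alpha_gt0 : 0 < alpha) (r_gt0 : 0 < r).
Hypothesis u_cont : {within ecball r, continuous u}.
Hypothesis u_deriv : forall x i, eball r x -> derivable u x (evec i).
Hypothesis u_decr : radially_decreasing (ecball r) u.
Variable G : 'rV[R]_n.+1 -> 'rV[R]_n.+1.
Hypothesis G_grad : forall x, eball r x -> G x = grad u x.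
Variable C : R.
Hypothesis G_holder : forall x y, ecball r x -> ecball r y ->
  enorm (G x - G y) <= C * enorm (x - y) `^ alpha.

(** The slope is read off the Hoelder extension [G] of the gradient rather than
    off [U], so that it is defined and continuous up to [t = r]. *)
Definition radial_slope (t : R) : R := - G (axis t) 0 0.
Let V := radial_slope.
Let U (t : R) := u (axis t).

Lemma ecball_axis t : `|t| <= r -> ecball r (axis t : 'rV[R]_n.+1).
Proof. by rewrite /ecball/= enorm_axis. Qed.

Lemma eball_axis t : `|t| < r -> eball r (axis t : 'rV[R]_n.+1).
Proof. by rewrite /eball/= enorm_axis. Qed.

Lemma axisB s t : axis s - axis t = axis (s - t) :> 'rV[R]_n.+1.
Proof. by rewrite /axis scalerBl. Qed.

Lemma radial_slope_cont : {within `[0, r], continuous V}.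
Proof.
apply/subspace_continuousP => t; rewrite /= in_itv/= => /andP[t0 tr].
apply/cvgrPdist_le => e e0.
have C0 : 0 < `|C| + 1 by rewrite ltr_wpDl.
have eC : 0 < e / (`|C| + 1) by rewrite divr_gt0.
have [d d0 Hd] := powR_cvg_at0 alpha_gt0 eC.
exists d => //= s ts; rewrite in_itv/= => /andP[s0 sr].
have H : `|V t - V s| <= enorm (G (axis t) - G (axis s)).
  rewrite (_ : V t - V s = - (G (axis t) - G (axis s)) 0 0); last first.
    by rewrite /V /radial_slope !mxE; ring.
  by rewrite normrN coord_le_enorm.
apply: le_trans H _; apply: le_trans (G_holder _ _) _.
- by apply: ecball_axis; rewrite ger0_norm.
- by apply: ecball_axis; rewrite ger0_norm.
rewrite axisB enorm_axis.
apply: (@le_trans _ _ ((`|C| + 1) * `|t - s| `^ alpha)).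
  rewrite ler_wpM2r ?powR_ge0//; have := ler_norm C; lra.
by rewrite mulrC -ler_pdivlMr//; apply: Hd => //; exact: ltW.
Qed.

Lemma radial_profile_deriv (t : R) : `|t| < r -> is_derive t 1 U (- V t).
Proof.
move=> tr; have xr := eball_axis tr.
have VE : - V t = 'D_(evec 0) u (axis t).
  by rewrite /V /radial_slope opprK G_grad// mxE.
have E : (fun h : R => h^-1 *: ((U \o shift t) (h *: (1 : R)) - U t)) =
   (fun h : R => h^-1 *: ((u \o shift (axis t)) (h *: evec 0) - u (axis t))).
  apply/funext => h /=; rewrite /U /axis -scalerDl [h *: 1]mulr1.
  by [].
apply: DeriveDef.
  by rewrite /derivable E; exact: u_deriv.
by rewrite VE /derive E.
Qed.

Lemma radial_profile_cont : {within `[0, r], continuous U}.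
Proof.
apply/subspace_continuousP => t; rewrite /= in_itv/= => /andP[t0 tr].
have ct : ecball r (axis t : 'rV[R]_n.+1) by apply: ecball_axis; rewrite ger0_norm.
have /subspace_continuousP/(_ _ ct)/cvgrPdist_lt ut := u_cont.
have ca : axis s @[s --> t] --> (axis t : 'rV[R]_n.+1).
  by apply: cvgZr_tmp; exact: cvg_id.
apply/cvgrPdist_lt => e e0; have := ut e e0; rewrite near_withinE => H0.
have [d /= d0 Hd] := ca _ H0.
exists d => //= s ts; rewrite in_itv/= => /andP[s0 sr].
by apply: (Hd s ts); apply: ecball_axis; rewrite ger0_norm.
Qed.

Lemma radial_profile_homo s t : 0 <= s -> s <= t -> t <= r -> U t <= U s.
Proof.
move=> s0 st tr; case: u_decr => _; apply.
- by apply: ecball_axis; rewrite ger0_norm//; lra.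
- by apply: ecball_axis; rewrite ger0_norm//; lra.
- by rewrite !enorm_axis !ger0_norm//; lra.
Qed.

Lemma radial_slope_ge0 t : 0 <= t <= r -> 0 <= V t.
Proof.
have pos s : 0 < s < r -> 0 <= V s.
  move=> /andP[s0 sr]; rewrite -oppr_le0.
  have D : is_derive s 1 U (- V s) by apply: radial_profile_deriv; rewrite gtr0_norm.
  case: D => dU <-; apply: limr_le => //.
  exists (Num.min s (r - s)); first by rewrite /= lt_min s0 subr_gt0.
  move=> h; rewrite /= sub0r normrN lt_min ltr_norml => /andP[/andP[hs _] hr] h0.
  rewrite [h *: 1]mulr1; have {}hr := le_lt_trans (ler_norm _) hr.
  move: h0; rewrite neq_lt => /orP[h0|h0].
    rewrite nmulr_rle0 ?invr_lt0// subr_ge0.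
    by apply: radial_profile_homo; lra.
  rewrite pmulr_rle0 ?invr_gt0// subr_le0.
  by apply: radial_profile_homo; lra.
move=> tr; rewrite leNgt; apply/negP => Vt.
have [e e0 He] := within_cont_lt radial_slope_cont (ltac:(by rewrite in_itv) : t \in `[0, r]) Vt.
have rr := r_gt0.
pose s := if t < r / 2 then Num.min (t + e / 2) (r / 2) else Num.max (t - e / 2) (r / 4).
have [s1 s2] : 0 < s < r /\ `|s - t| < e.
  rewrite /s; case: ifPn; rewrite -?leNgt => tr2.
    rewrite /Num.min; case: ifP => tm; split; try lra.
      by rewrite ger0_norm; lra.
    have := negbT tm; rewrite -leNgt => tm'.
    by rewrite ger0_norm; lra.
  rewrite /Num.max; case: ifP => tm; split; try lra.
    by rewrite ler0_norm; lra.
  have := negbT tm; rewrite -leNgt => tm'.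
  by rewrite ler0_norm; lra.
have := pos s s1; rewrite leNgt He// in_itv/=; lra.
Qed.

(** [U] is even. *)
Lemma radial_slope0 : V 0 = 0.
Proof.
have rr := r_gt0.
have D : is_derive (0 : R) 1 U (- V 0) by apply: radial_profile_deriv; rewrite normr0.
have DN : is_derive (0 : R) 1 U (V 0).
  apply: (@near_eq_is_derive R R R (fun t => U (- t))).
    exists r => //= t; rewrite /ball_/= sub0r normrN => tr /=.
    apply: (proj1 u_decr); last by rewrite !enorm_axis normrN.
      by apply: ecball_axis; rewrite normrN ltW.
    by apply: ecball_axis; rewrite ltW.
  rewrite -[V 0]opprK -mulrN1.
  have D' : is_derive (- 0 : R) 1 U (- V 0) by rewrite oppr0.
  have Dopp : is_derive (0 : R) 1 (fun t : R => - t) (- 1) by exact: is_deriveNid.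
  exact: (@is_derive1_comp R U (fun t => - t) 0 _ _ D' Dopp).
have := @derive_val _ _ _ _ _ _ _ D; rewrite (@derive_val _ _ _ _ _ _ _ DN).
lra.
Qed.

(** Chain rule for [u = U o |.|] off the origin. *)
Lemma grad_radial x : eball r x -> x != 0 ->
  grad u x = (- (V (enorm x) / enorm x)) *: x.
Proof.
move=> xr x0; apply/rowP => i; rewrite !mxE.
have d0 : 0 < dotp x x.
  rewrite lt_neqAle dotp_ge0 andbT eq_sym; apply: contra_neq x0 => d0.
  by apply: enorm0_eq0; rewrite /enorm d0 sqrtr0.
have ex0 : 0 < enorm x by rewrite sqrtr_gt0.
have Ds := @is_derive_comp_dir _ _ (fun x => dotp x x) _ x _ _ _
  (is_derive1_sqrt d0) (is_derive_dotp x i).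
have DU : is_derive (enorm x) 1 U (- V (enorm x)).
  by apply: radial_profile_deriv; rewrite ger0_norm ?enorm_ge0.
have DD := @is_derive_comp_dir _ _ (@enorm R n.+1) _ x _ _ _ DU Ds.
have D : is_derive x (evec i) u (- V (enorm x) * ((2 * Num.sqrt (dotp x x))^-1 * (2 * x 0 i))).
  apply: near_eq_is_derive DD.
  have := @open_eball R n.+1 r; rewrite openE => /(_ x xr).
  apply: filterS => y yr /=; apply: (proj1 u_decr).
  - apply: ecball_axis; rewrite ger0_norm ?enorm_ge0//; exact: ltW.
  - exact: ltW.
  - by rewrite enorm_axis ger0_norm ?enorm_ge0.
rewrite (@derive_val _ _ _ _ _ _ _ D) -/(enorm x); field.
by rewrite gt_eqF.
Qed.

Lemma dotp_flux_radial (s : R) x : 1 < s -> eball r x -> x != 0 ->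
  dotp (flux s (grad u x)) x = - (enorm x * V (enorm x) `^ (s - 1)).
Proof.
move=> s1 xr x0; rewrite grad_radial// /flux.
have ex0 : 0 < enorm x.
  rewrite lt_neqAle enorm_ge0 andbT eq_sym; apply: contra_neq x0.
  exact: enorm0_eq0.
have V0 : 0 <= V (enorm x) by apply: radial_slope_ge0; rewrite enorm_ge0/= ltW.
rewrite enormZ normrN ger0_norm ?divr_ge0 ?(ltW ex0)// divfK ?gt_eqF//.
rewrite !dotpZl -sqr_enorm -(@mulr_powRB1 _ (V (enorm x)) (s - 1))//; last by rewrite subr_gt0.
rewrite (_ : s - 1 - 1 = s - 2); last by ring.
by field; rewrite gt_eqF.
Qed.

End radial_calculus.

(** * Positivity *)

Section positivity.
Context {R : realType} {n : nat}.
Variables (c delta r : R) (h u : 'rV[R]_n.+1 -> R).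
Hypotheses (c_gt0 : 0 < c) (delta_gt0 : 0 < delta) (r_gt0 : 0 < r).
Hypothesis u_decr : radially_decreasing (ecball r) u.
Hypothesis u_bound : forall x, esphere r x -> u x = 0.
Hypothesis u_int : loc_integrable (eball r) (source c delta h u).
Local Notation mu := (@lebesgue_rV R n.+1).

Lemma source_eqy x : u x = 0 -> source c delta h u x = +oo%E.
Proof.
by move=> ux; rewrite /source ux powR0 ?gt_eqF// inve0 gt0_muley ?lte_fin.
Qed.

Lemma source_fin x : 0 < u x ->
  source c delta h u x = (c * u x `^ (- delta) + h x)%:E.
Proof.
move=> ux; rewrite /source inver gt_eqF ?powR_gt0// powRN.
by [].
Qed.

Lemma compact_shell (s t : R) : compact [set x : 'rV[R]_n.+1 | s <= enorm x <= t].
Proof.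
apply: (subclosed_compact _ (@compact_ecball R n.+1 t)); last first.
  by move=> x /= /andP[].
rewrite (_ : mkset _ = enorm @^-1` [set z | s <= z] `&` ecball t).
  apply: closedI; last exact: closed_ecball.
  by apply: preimage_closed => [x _|]; [exact: continuous_enorm|exact: closed_ge].
by apply/seteqP; split => x /=; rewrite /ecball/=; [move=> /andP[]|move=> [? ?]; apply/andP].
Qed.

Lemma solution_ge0 x : ecball r x -> 0 <= u x.
Proof.
move=> xr; have er : enorm (axis r : 'rV[R]_n.+1) = r.
  by rewrite enorm_axis ger0_norm// ltW.
rewrite -(u_bound er); case: u_decr => _; apply => //; rewrite ?er//.
by rewrite /ecball/= er.
Qed.

(** A zero at [x] would make [u] vanish wherever [|x| <= |y| <= r]. A compact
    shell in this region has positive measure because balls of different radii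
    have different volumes, and on it the source is identically infinite. *)
Lemma solution_gt0 x : eball r x -> 0 < u x.
Proof.
move=> xr; rewrite ltNge; apply/negP => ux0.
have {ux0}ux : u x = 0.
  by apply/eqP; rewrite eq_le ux0 solution_ge0//; exact: ltW.
have t0 := enorm_ge0 x; have t0r : enorm x < r by [].
pose t1 := (2 * enorm x + r) / 3; pose t2 := (enorm x + 2 * r) / 3.
have t01 : enorm x < t1 by rewrite /t1; lra.
have t12 : t1 < t2 by rewrite /t1 /t2; lra.
have t2r : t2 < r by rewrite /t2; lra.
pose K := [set x : 'rV[R]_n.+1 | t1 <= enorm x <= t2].
have uK y : K y -> u y = 0.
  move=> /andP[y1 y2]; apply/eqP; rewrite eq_le solution_ge0 ?andbT; last first.
    by rewrite /ecball/=; lra.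
  rewrite -ux; case: u_decr => _; apply; rewrite /ecball/=; lra.
have iK : mu.-integrable K (source c delta h u).
  apply: u_int; first exact: compact_shell.
  by move=> y /andP[_ y2]; rewrite /eball/=; lra.
have mK : measurable K.
  rewrite (_ : K = enorm @^-1` `[t1, t2]).
    by rewrite -[X in measurable X]setTI; apply: measurable_enorm => //; exact: measurable_itv.
  by apply/seteqP; split => y; rewrite /K/= in_itv.
have muK : (0 < mu K)%E.
  rewrite lt_neqAle measure_ge0 andbT eq_sym; apply/eqP => muK0.
  have sub : ecball t2 `<=` ecball t1 `|` K.
    move=> y; rewrite /ecball/K/= => yt2.
    by have [?|/ltW ?] := leP (enorm y) t1; [left|right; apply/andP].
  have : (mu (ecball t2) <= mu (ecball t1) + mu K)%E.
    apply: (@le_trans _ _ (mu (ecball t1 `|` K))); last first.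
      by apply: measureU2 => //; exact: measurable_ecball.
    apply: le_measure; rewrite ?inE//; first exact: measurable_ecball.
    by apply: measurableU => //; exact: measurable_ecball.
  rewrite muK0 adde0 !lebesgue_rV_ecball; [|lra|lra].
  rewrite lee_fin ler_pM2r ?unit_ball_volume_pos// leNgt ltrXn2r ?nnegrE//; lra.
have := integrable_fin_num mK iK.
rewrite (_ : (\int[mu]_(x in K) _)%E = +oo%E)//.
rewrite (eq_integral (cst +oo%E)) => [|y]; last first.
  by rewrite inE => /uK /source_eqy.
by rewrite integral_cst// gt0_mulye.
Qed.

End positivity.

(** * The flux through a sphere *)

(** Moves integrals over the open ball to a smaller closed ball, where the source
    is integrable. *)
Lemma integral_vanishing d (T : measurableType d) (R : realType)
    (mu : {measure set T -> \bar R}) (A B : set T) (f : T -> \bar R) :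
  A `<=` B -> (forall x, B x -> ~ A x -> f x = 0%E) ->
  (\int[mu]_(x in B) f x = \int[mu]_(x in A) f x)%E.
Proof.
move=> AB f0; rewrite integral_mkcond [RHS]integral_mkcond.
apply: eq_integral => x _; rewrite !patchE.
case: (boolP (x \in B)) => xB; case: (boolP (x \in A)) => xA //.
  by apply: f0; [rewrite -in_setE|move/mem_set; apply/negP].
by move: xB => /negP; case; apply/mem_set/AB; rewrite -in_setE.
Qed.

Section radial_flux.
Context {R : realType} {n : nat}.
Local Notation N := n.+1.
Local Notation mu := (@lebesgue_rV R N).
Variables (p q r : R) (f : 'rV[R]_N -> R) (V : R -> R).
Hypothesis V_cont : {within `[0, r], continuous V}.
Hypothesis f_ge0 : forall x, eball r x -> 0 <= f x.
Hypothesis f_int : forall t : R, 0 < t < r -> mu.-integrable (ecball t) (EFin \o f).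

(** The modulus of the sum of the two fluxes at a gradient of length [t]. *)
Definition pq_power (t : R) : R := t `^ (p - 1) + t `^ (q - 1).
Let A := pq_power.

Lemma pq_power_ge0 t : 0 <= A t.
Proof. by rewrite addr_ge0 ?powR_ge0. Qed.

(** The distributional equation tested against radial cutoffs. *)
Hypothesis weak : forall a b : R, 0 < a -> a < b -> b < r ^+ 2 ->
  (\int[mu]_(x in eball r)
     (2 * cutoff_slope a b (dotp x x) * (enorm x * A (V (enorm x))))%:E =
   \int[mu]_(x in eball r) (f x * cutoff a b (dotp x x))%:E)%E.

Definition ball_mass (t : R) : R := \int[mu]_(x in ecball t) f x.
Let H := ball_mass.
Let w := @unit_ball_volume R N.

Lemma enorm_le_sqr (x : 'rV[R]_N) t : 0 <= t -> (enorm x <= t) = (dotp x x <= t ^+ 2).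
Proof.
by move=> t0; rewrite -sqr_enorm ler_pXn2r// nnegrE enorm_ge0.
Qed.

Lemma integral_cutoff_bounds (s t : R) : 0 < s -> s < t ->
  w * s ^+ N <= \int[mu]_x cutoff (s ^+ 2) (t ^+ 2) (dotp x x) <= w * t ^+ N.
Proof.
move=> s0 st; have t0 : 0 < t by apply: lt_trans st.
have st2 : s ^+ 2 < t ^+ 2 by rewrite ltrXn2r ?nnegrE// ltW.
have i := @integrable_cutoff R N _ _ (sqr_ge0 s) st2.
have E a : 0 < a -> w * a ^+ N = fine (\int[mu]_(x in setT) (\1_(ecball a) x)%:E)%E.
  move=> a0; rewrite integral_indic ?setIT//; last exact: measurable_ecball.
  by rewrite [X in fine X]lebesgue_rV_ecball//= mulrC.
have I a : 0 < a -> mu.-integrable setT (fun x => (\1_(ecball a) x)%:E).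
  exact: integrable_indic_ecball.
rewrite E// E//; apply/andP; split.
- apply: le_Rintegral => //; first exact: I.
  move=> x _; rewrite indicE; case: (boolP (x \in _)) => [|_]; last exact: cutoff_ge0.
  by rewrite inE /ecball/= enorm_le_sqr ?(ltW s0)// => xs; rewrite cutoff_eq1.
- apply: le_Rintegral => //; first exact: I.
  move=> x _; rewrite indicE; case: (boolP (x \in _)) => [_|]; first exact: cutoff_le1.
  rewrite notin_setE /ecball/= enorm_le_sqr ?(ltW t0)// => /negP; rewrite -ltNge => xt.
  by rewrite cutoff_eq0// ltW.
Qed.

Section shell.
Variables (s t : R).
Hypotheses (s_gt0 : 0 < s) (st : s < t) (tr : t < r).
Let a := s ^+ 2.
Let b := t ^+ 2.
Let t_gt0 : 0 < t. Proof. exact: lt_trans st. Qed.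
Let ab : a < b. Proof. by rewrite ltrXn2r ?nnegrE// ltW. Qed.
Let br : b < r ^+ 2. Proof. by rewrite ltrXn2r ?nnegrE// ltW. Qed.
Let a_gt0 : 0 < a. Proof. by rewrite exprn_gt0. Qed.
Let theta := cutoff_slope a b.
Let psi := cutoff a b.
Let P := \int[mu]_x psi (dotp x x).

Let theta_ge0 y : 0 <= 2 * theta y.
Proof. by rewrite mulr_ge0// cutoff_slope_ge0. Qed.

Let out (x : 'rV[R]_N) : ~ ecball t x -> b <= dotp x x.
Proof.
by rewrite /ecball/= enorm_le_sqr ?(ltW t_gt0)// => /negP; rewrite -ltNge => /ltW.
Qed.

Let tball : ecball t `<=` (eball r : set 'rV[R]_N).
Proof. by move=> x; rewrite /ecball/eball/= => /le_lt_trans; apply. Qed.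

Let weak_shell :
  (\int[mu]_(x in ecball t)
     (2 * theta (dotp x x) * (enorm x * A (V (enorm x))))%:E =
   \int[mu]_(x in ecball t) (f x * psi (dotp x x))%:E)%E.
Proof.
rewrite -(@integral_vanishing _ _ _ mu _ _ _ tball); last first.
  by move=> x _ /out bx; rewrite /theta cutoff_slope_out ?mulr0 ?mul0r//; right.
rewrite -[RHS](@integral_vanishing _ _ _ mu _ _ _ tball); last first.
  by move=> x _ /out bx; rewrite /psi cutoff_eq0 ?mulr0.
exact: weak.
Qed.

Let slope_mass : (\int[mu]_(x in ecball t) (2 * theta (dotp x x) * dotp x x)%:E = (N%:R * P)%:E)%E.
Proof.
rewrite -(@integral_vanishing _ _ _ mu (ecball t) setT _) //; last first.
  by move=> x _ /out bx; rewrite /theta cutoff_slope_out ?mulr0 ?mul0r//; right.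
rewrite -(@integral_cutoff_slope R N _ _ (ltW a_gt0) ab) fineK//.
by apply: integrable_fin_num => //; exact: integrable_cutoff_slope (ltW a_gt0) ab.
Qed.

Let m_slope : measurable_fun (ecball t) (fun x : 'rV[R]_N => theta (dotp x x)).
Proof.
apply: measurable_funTS; exact: measurable_radial (continuous_cutoff_slope ab).
Qed.

Let m_psi : measurable_fun (ecball t) (fun x : 'rV[R]_N => psi (dotp x x)).
Proof.
apply: measurable_funTS; exact: measurable_radial (continuous_cutoff ab).
Qed.

Let m_flux : measurable_fun (ecball t)
  (fun x : 'rV[R]_N => 2 * theta (dotp x x) * (enorm x * A (V (enorm x)))).
Proof.
have me : measurable_fun (ecball t) (@enorm R N : _ -> R).
  exact: measurable_funTS measurable_enorm.
have mV : measurable_fun (ecball t) (fun x : 'rV[R]_N => V (enorm x)).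
  apply: (@measurable_comp _ _ _ _ _ _ `[0, r] V (ecball t) (@enorm R N)) => //.
  - move=> _ [x xt <-] /=; rewrite in_itv/= enorm_ge0/=.
    by apply: le_trans xt _; exact: ltW.
  - apply: measurable_realfun.subspace_continuous_measurable_fun => //.
apply: measurable_funM; first exact: measurable_funM.
apply: measurable_funM => //; apply: measurable_funD.
  exact: (measurableT_comp (@measurable_powR R (p - 1)) mV).
exact: (measurableT_comp (@measurable_powR R (q - 1)) mV).
Qed.

Let m_mass : measurable_fun (ecball t)
  (fun x : 'rV[R]_N => (2 * theta (dotp x x) * dotp x x)%:E).
Proof.
apply/measurable_EFinP; apply: measurable_funM; first exact: measurable_funM.
exact: measurable_funTS (measurable_radial (fun=> cvg_id)).
Qed.

Let mass_ge0 (x : 'rV[R]_N) : (0 <= (2 * theta (dotp x x) * dotp x x)%:E)%E.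
Proof. by rewrite lee_fin (mulr_ge0 (theta_ge0 _))// dotp_ge0. Qed.

Let mH : measurable_fun (ecball t) f.
Proof.
have tr' : 0 < t < r by rewrite t_gt0.
by apply/measurable_EFinP; have /integrableP[] := f_int tr'.
Qed.

(** A bound on [a(V)] over the shell bounds the flux through it by a multiple of
    [integral_cutoff_slope], while the tested source dominates the mass of the
    inner ball. *)
Lemma mass_shell_le M : 0 <= M -> (forall x, s <= x <= t -> A (V x) <= M * x) ->
  H s <= M * (N%:R * w * t ^+ N).
Proof.
move=> M0 HM; have sr : 0 < s < r by rewrite s_gt0 (lt_trans st).
have mt := @measurable_ecball R N t; have ms := @measurable_ecball R N s.
rewrite -lee_fin /H /ball_mass fineK; last first.
  exact: integrable_fin_num (f_int sr).
have sub : ecball s `<=` (ecball t : set 'rV[R]_N).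
  by move=> x; rewrite /ecball/= => /le_trans; apply; exact: ltW.
have mfp : measurable_fun (ecball t) (fun x : 'rV[R]_N => (f x * psi (dotp x x))%:E).
  by apply/measurable_EFinP; exact: measurable_funM.
have fp0 x : ecball t x -> (0 <= (f x * psi (dotp x x))%:E)%E.
  by move=> /tball xr; rewrite lee_fin mulr_ge0 ?f_ge0// cutoff_ge0.
apply: (@le_trans _ _ (\int[mu]_(x in ecball t) (f x * psi (dotp x x))%:E)%E).
  apply: le_trans (ge0_subset_integral mu ms mt mfp fp0 sub).
  rewrite le_eqVlt; apply/orP; left; apply/eqP; apply: eq_integral => x.
  rewrite inE /ecball/= enorm_le_sqr ?(ltW s_gt0)// => xs.
  by rewrite /psi cutoff_eq1// mulr1.
rewrite -weak_shell.
apply: (@le_trans _ _ (\int[mu]_(x in ecball t) (M%:E * (2 * theta (dotp x x) * dotp x x)%:E))%E).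
  apply: ge0_le_integral => //.
  - move=> x xt; rewrite lee_fin (mulr_ge0 (theta_ge0 _))//.
    by rewrite mulr_ge0 ?enorm_ge0 ?pq_power_ge0.
  - exact/measurable_EFinP.
  - exact: measurable_funeM.
  - move=> x xt; rewrite -EFinM lee_fin [leRHS]mulrCA.
    have [xa|xa] := leP (dotp x x) a.
      by rewrite /theta cutoff_slope_out; [rewrite !(mulr0, mul0r)|left].
    rewrite ler_wpM2l ?theta_ge0// -sqr_enorm expr2 [leRHS]mulrCA ler_wpM2l ?enorm_ge0//.
    apply: HM; rewrite xt andbT leNgt; apply/negP => /ltW.
    by rewrite enorm_le_sqr ?(ltW s_gt0)// leNgt xa.
rewrite ge0_integralZl// slope_mass -EFinM lee_fin ler_wpM2l//.
have /andP[_ Pt] := integral_cutoff_bounds s_gt0 st.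
by rewrite -mulrA ler_wpM2l.
Qed.

(** The same with the roles of the inner and the outer ball exchanged. *)
Lemma mass_shell_ge m : 0 <= m -> (forall x, s <= x <= t -> m * x <= A (V x)) ->
  m * (N%:R * w * s ^+ N) <= H t.
Proof.
move=> m0 Hm; have tr' : 0 < t < r by rewrite t_gt0.
have mt := @measurable_ecball R N t.
rewrite -lee_fin /H /ball_mass fineK; last first.
  exact: integrable_fin_num (f_int tr').
apply: (@le_trans _ _ (\int[mu]_(x in ecball t) (f x * psi (dotp x x))%:E)%E); last first.
  apply: ge0_le_integral => //.
  - by move=> x /tball xr; rewrite lee_fin mulr_ge0 ?f_ge0// cutoff_ge0.
  - by apply/measurable_EFinP; exact: measurable_funM.
  - exact/measurable_EFinP.
  - by move=> x /tball xr; rewrite lee_fin ler_piMr ?f_ge0// cutoff_le1.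
rewrite -weak_shell.
apply: (@le_trans _ _ (\int[mu]_(x in ecball t) (m%:E * (2 * theta (dotp x x) * dotp x x)%:E))%E).
  rewrite ge0_integralZl// slope_mass -EFinM lee_fin ler_wpM2l//.
  have /andP[Ps _] := integral_cutoff_bounds s_gt0 st.
  by rewrite -mulrA ler_wpM2l.
apply: ge0_le_integral => //.
- by move=> x xt; rewrite mule_ge0.
- exact: measurable_funeM.
- exact/measurable_EFinP.
- move=> x xt; rewrite -EFinM lee_fin [leLHS]mulrCA.
  have [xa|xa] := leP (dotp x x) a.
    by rewrite /theta cutoff_slope_out; [rewrite !(mulr0, mul0r)|left].
  rewrite ler_wpM2l ?theta_ge0// -sqr_enorm expr2 [leLHS]mulrCA ler_wpM2l ?enorm_ge0//.
  apply: Hm; rewrite xt andbT leNgt; apply/negP => /ltW.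
  by rewrite enorm_le_sqr ?(ltW s_gt0)// leNgt xa.
Qed.

End shell.

Hypothesis flux_cont : {within `[0, r], continuous (fun t => A (V t))}.

Lemma ball_mass_ge0 t : 0 < t < r -> 0 <= H t.
Proof.
move=> /andP[t0 tr]; apply: Rintegral_ge0 => x xt; apply: f_ge0.
exact: le_lt_trans xt tr.
Qed.

(** The flux identity: the shell with ends [t] and [t + x] gives one inequality,
    the shell with ends [t - x] and [t] the other, as [x] tends to 0. *)
Lemma ball_mass_flux t : 0 < t < r -> H t = N%:R * w * (t ^+ n * A (V t)).
Proof.
move=> /andP[t0 tr]; pose k := A (V t) / t.
have k0 : 0 <= k by rewrite divr_ge0 ?pq_power_ge0// ltW.
have -> : N%:R * w * (t ^+ n * A (V t)) = k * (N%:R * w * t ^+ N).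
  by rewrite exprS /k; field; rewrite gt_eqF.
have close e : 0 < e -> exists2 d, 0 < d & forall x, 0 < x < r -> `|x - t| < d ->
    (k - e) * x <= A (V x) /\ A (V x) <= (k + e) * x.
  move=> e0.
  have tin : t \in `[0, r] by rewrite in_itv/= !ltW.
  have lin (z : R) : {within `[0, r], continuous (fun x => z * x)}.
    by apply: continuous_subspaceT => x; apply: cvgMr; exact: cvg_id.
  have cU := within_cont_B flux_cont (lin (k + e)).
  have cL := within_cont_B (lin (k - e)) flux_cont.
  have kt : k * t = A (V t) by rewrite /k divfK// gt_eqF.
  have et : 0 < e * t by rewrite mulr_gt0.
  have [|d1 d10 H1] := within_cont_lt cU tin (k := 0); first by rewrite mulrDl kt; lra.
  have [|d2 d20 H2] := within_cont_lt cL tin (k := 0); first by rewrite mulrBl kt; lra.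
  exists (Num.min d1 d2); first by rewrite lt_min d10.
  move=> x /andP[x0 xr]; rewrite lt_min => /andP[xd1 xd2].
  have xin : x \in `[0, r] by rewrite in_itv/= !ltW.
  by have := H1 x xin xd1; have := H2 x xin xd2; lra.
have trr : 0 < r - t by rewrite subr_gt0.
apply/eqP; rewrite eq_le; apply/andP; split.
- apply: (@le_perturbed_monomial _ _ _ _ _ _ (r - t)) => // e /andP[e0 er].
  have [d d0 Hd] := close e e0.
  pose x := t + Num.min (d / 2) e.
  have m0 : 0 < Num.min (d / 2) e by rewrite lt_min e0 andbT divr_gt0.
  have md : Num.min (d / 2) e <= d / 2 by rewrite ge_min lexx.
  have me : Num.min (d / 2) e <= e by rewrite ge_min lexx orbT.
  have tx : t < x by rewrite /x; lra.
  have xr : x < r by rewrite /x; lra.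
  have ke : 0 <= k + e by lra.
  apply: le_trans (@mass_shell_le t x t0 tx xr (k + e) ke _) _.
    move=> y /andP[ty yx]; have yr : 0 < y < r by lra.
    by apply: (proj2 (Hd y yr _)); rewrite ger0_norm ?subr_ge0//; rewrite /x in yx; lra.
  rewrite ler_wpM2l// ler_wpM2l ?mulr_ge0 ?(ltW unit_ball_volume_pos)//.
  by rewrite lerXn2r ?nnegrE//; rewrite /x; lra.
- apply: (@ge_perturbed_monomial _ _ _ _ _ _ t) => // e /andP[e0 er].
  have [ke|ke] := leP (k - e) 0.
    apply: le_trans (@ball_mass_ge0 t _); last by rewrite t0.
    rewrite mulr_le0_ge0// !mulr_ge0 ?exprn_ge0 ?(ltW unit_ball_volume_pos)//; lra.
  have [d d0 Hd] := close e e0.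
  pose x := t - Num.min (d / 2) e.
  have m0 : 0 < Num.min (d / 2) e by rewrite lt_min e0 andbT divr_gt0.
  have md : Num.min (d / 2) e <= d / 2 by rewrite ge_min lexx.
  have me : Num.min (d / 2) e <= e by rewrite ge_min lexx orbT.
  have tx : x < t by rewrite /x; lra.
  have x0 : 0 < x by rewrite /x; lra.
  apply: le_trans (@mass_shell_ge x t x0 tx tr (k - e) (ltW ke) _).
    rewrite ler_wpM2l ?(ltW ke)// ler_wpM2l ?mulr_ge0 ?(ltW unit_ball_volume_pos)//.
    by rewrite lerXn2r ?nnegrE//; rewrite /x; lra.
  move=> y /andP[xy yt]; have yr : 0 < y < r by lra.
  by apply: (proj1 (Hd y yr _)); rewrite ler0_norm ?subr_le0//; rewrite /x in xy; lra.
Qed.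

End radial_flux.

(** * Differentiating the mass of a ball *)

(** Differentiation against another function [K], which stands for the volume:
    [F] inherits a derivative from [K] if its increments are asymptotically [f]
    times those of [K]. *)
Lemma is_derive_sandwich (R : realType) (F K : R -> R) (f t K' : R) :
  is_derive t 1 K K' ->
  (forall e : R, 0 < e -> exists2 d : R, 0 < d & forall s : R, `|s - t| < d ->
     `|F s - F t - f * (K s - K t)| <= e * `|K s - K t|) ->
  is_derive t 1 F (f * K').
Proof.
move=> [dK KE] HF.
have cK : h^-1 *: (K (h + t) - K t) @[h --> 0^'] --> K'.
  rewrite -KE; have := dK; rewrite /derivable.
  rewrite (_ : (fun h : R => h^-1 *: ((K \o shift t) (h *: (1 : R)) - K t)) =
     (fun h : R => h^-1 *: (K (h + t) - K t))); last first.
    by apply/funext => h /=; rewrite [h *: 1]mulr1.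
  move=> c; rewrite /derive.
  rewrite (_ : (fun h : R => h^-1 *: ((K \o shift t) (h *: (1 : R)) - K t)) =
     (fun h : R => h^-1 *: (K (h + t) - K t))) //.
  by apply/funext => h /=; rewrite [h *: 1]mulr1.
have cF : h^-1 *: (F (h + t) - F t) @[h --> 0^'] --> f * K'.
  apply/cvgrPdist_le => e e0.
  pose e1 := e / (2 * (`|K'| + 1)).
  have K1 : 0 < `|K'| + 1 by rewrite ltr_wpDl.
  have e10 : 0 < e1 by rewrite divr_gt0// mulr_gt0.
  have [d d0 Hd] := HF e1 e10.
  pose e2 := Num.min 1 (e / (2 * (`|f| + 1))).
  have f1 : 0 < `|f| + 1 by rewrite ltr_wpDl.
  have e20 : 0 < e2 by rewrite lt_min ltr01 divr_gt0// mulr_gt0.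
  move/cvgrPdist_le : (cK) => /(_ _ e20) [d2 /= d20 Hd2].
  exists (Num.min d d2); first by rewrite /= lt_min d0.
  move=> h; rewrite /ball_/= sub0r normrN lt_min => /andP[hd hd2] h0.
  have := Hd2 h; rewrite /ball_/= sub0r normrN => /(_ hd2 h0).
  rewrite /GRing.scale/=; set Q := h^-1 * (K (h + t) - K t) => HQ.
  have Q1 : `|K' - Q| <= 1 by apply: le_trans HQ _; rewrite ge_min lexx.
  have Q2 : `|K' - Q| <= e / (2 * (`|f| + 1)) by apply: le_trans HQ _; rewrite ge_min lexx orbT.
  have := Hd (h + t); rewrite addrK => /(_ hd) H.
  have H2 : `|h^-1 * (F (h + t) - F t) - f * Q| <= e1 * `|Q|.
    rewrite (_ : _ - _ = h^-1 * (F (h + t) - F t - f * (K (h + t) - K t))); last first.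
      by rewrite /Q; ring.
    rewrite normrM /Q normrM mulrCA; exact: ler_wpM2l.
  have Qn : `|Q| <= `|K'| + 1.
    rewrite -(subrK K' Q) addrC; apply: le_trans (ler_normD _ _) _.
    by rewrite lerD2l distrC.
  have H3 : e1 * `|Q| <= e / 2.
    apply: (@le_trans _ _ (e1 * (`|K'| + 1))); first by rewrite ler_wpM2l// ltW.
    by rewrite le_eqVlt; apply/orP; left; rewrite /e1; apply/eqP; field; rewrite gt_eqF.
  have H4 : `|f| * `|K' - Q| <= e / 2.
    apply: (@le_trans _ _ ((`|f| + 1) * (e / (2 * (`|f| + 1))))).
      by apply: ler_pM => //; lra.
    by rewrite le_eqVlt; apply/orP; left; apply/eqP; field; rewrite gt_eqF.
  rewrite (_ : f * K' - _ = f * (K' - Q) - (h^-1 * (F (h + t) - F t) - f * Q)); last by ring.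
  apply: le_trans (ler_normB _ _) _; rewrite normrM.
  have := le_trans H2 H3; lra.
rewrite (_ : (fun h : R => h^-1 *: (F (h + t) - F t)) =
     (fun h : R => h^-1 *: ((F \o shift t) (h *: (1 : R)) - F t))) in cF; last first.
  by apply/funext => h /=; rewrite [h *: 1]mulr1.
by apply: DeriveDef; [apply/cvg_ex; exists (f * K')|exact: cvg_lim cF].
Qed.

Section ball_mass_derivative.
Context {R : realType} {N : nat}.
Local Notation mu := (@lebesgue_rV R N).
Variables (r : R) (f : 'rV[R]_N -> R) (g : R -> R).
Hypothesis f_int : forall t : R, 0 < t < r -> mu.-integrable (ecball t) (EFin \o f).
Hypothesis fg : forall x, eball r x -> f x = g (enorm x).
Local Notation H := (fun t => \int[mu]_(x in ecball t) f x).
Let w := @unit_ball_volume R N.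

Let shell (s t : R) : set 'rV[R]_N := ecball t `\` ecball s.

Let ball_split (F : 'rV[R]_N -> R) s t : 0 < s -> s <= t ->
  mu.-integrable (ecball t) (EFin \o F) ->
  \int[mu]_(x in ecball t) F x =
  \int[mu]_(x in ecball s) F x + \int[mu]_(x in shell s t) F x.
Proof.
move=> s0 st i.
have E : ecball t = ecball s `|` shell s t.
  rewrite /shell setDUK// => x; rewrite /ecball/= => xs; exact: le_trans xs st.
rewrite {1}E Rintegral_setU//.
- exact: measurable_ecball.
- by apply: measurableD; exact: measurable_ecball.
- by rewrite -E.
- by apply/disj_setPS => x [xs [_ nxs]].
Qed.

Lemma ball_mass_increment s t m M : 0 < s -> s <= t -> t < r ->
  (forall x, s <= x <= t -> m <= g x <= M) ->
  m * (w * (t ^+ N - s ^+ N)) <= H t - H s <= M * (w * (t ^+ N - s ^+ N)).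
Proof.
move=> s0 st tr Hg; have t0 : 0 < t by apply: lt_le_trans st.
have msh : measurable (shell s t) by apply: measurableD; exact: measurable_ecball.
have sub : shell s t `<=` ecball t by move=> x [].
have it : mu.-integrable (ecball t) (EFin \o f) by apply: f_int; rewrite t0.
have icst (k : R) : mu.-integrable (ecball t) (EFin \o cst k).
  apply/integrableP; split; first exact/measurable_EFinP.
  under eq_integral do rewrite /=.
  rewrite integral_cst; last exact: measurable_ecball.
  by rewrite [X in (_ * X)%E]lebesgue_rV_ecball// -EFinM ltry.
have ice k a : 0 < a -> \int[mu]_(x in ecball a) (cst k x) = k * (w * a ^+ N).
  move=> a0; rewrite Rintegral_cst; last exact: measurable_ecball.
  by rewrite [X in fine X]lebesgue_rV_ecball//= mulrA mulrAC mulrA.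
have ish (k : R) : \int[mu]_(x in shell s t) (cst k x) = k * (w * (t ^+ N - s ^+ N)).
  have := ball_split s0 st (icst k); rewrite !ice// => E.
  have {}E : \int[mu]_(x in shell s t) (cst k x) = k * (w * t ^+ N) - k * (w * s ^+ N).
    by rewrite E addrC addKr.
  by rewrite E; ring.
have mt := @measurable_ecball R N t.
have iS := integrableS mt msh sub.
have -> : \int[mu]_(x in ecball t) f x - \int[mu]_(x in ecball s) f x =
    \int[mu]_(x in shell s t) f x by rewrite (ball_split s0 st it) addrC addKr.
rewrite -!ish.
apply/andP; split; apply: le_Rintegral => //; try exact: iS.
- move=> x [xt xs]; rewrite fg; last exact: le_lt_trans xt tr.
  have xst : s <= enorm x <= t by apply/andP; split=> //; rewrite ltW// ltNge; apply/negP.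
  by have /andP[] := Hg _ xst.
- move=> x [xt xs]; rewrite fg; last exact: le_lt_trans xt tr.
  have xst : s <= enorm x <= t by apply/andP; split=> //; rewrite ltW// ltNge; apply/negP.
  by have /andP[] := Hg _ xst.
Qed.

Lemma is_derive_ball_mass t : 0 < t < r -> g s @[s --> t] --> g t ->
  is_derive t 1 H (g t * (w * (N%:R * t ^+ N.-1))).
Proof.
move=> /andP[t0 tr] cg.
have DK : is_derive t 1 (fun s => w * s ^+ N) (w * (N%:R * t ^+ N.-1)).
  have D := is_deriveX N (is_derive_id t 1); rewrite exprfctE in D.
  by apply: is_derive_eq (is_deriveZ w D) _; rewrite /GRing.scale/= mulr1.
apply: is_derive_sandwich DK _ => e e0.
move/cvgrPdist_le : cg => /(_ e e0) [d /= d0 Hd].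
exists (Num.min d (Num.min t (r - t))).
  by rewrite !lt_min d0 t0 subr_gt0.
move=> s; rewrite !lt_min => /and3P[sd sm sr].
have [s0 {}sr] : 0 < s /\ s < r.
  by move: sm sr; rewrite !ltr_norml => /andP[? ?] /andP[? ?]; split; lra.
have w0 : 0 < w := unit_ball_volume_pos.
have gb x : `|x - t| < d -> g t - e <= g x <= g t + e.
  move=> xd; have tx : `|t - x| < d by rewrite distrC.
  by have := Hd x tx; rewrite /= distrC ler_norml => /andP[? ?]; apply/andP; split; lra.
have [st|ts] := leP s t.
  have /andP[L1 L2] := @ball_mass_increment s t (g t - e) (g t + e) s0 st tr
    (fun x (xs : s <= x <= t) => gb x ltac:(by move: sd; rewrite ler0_norm ?ler0_norm; lra)).
  have Kp : 0 <= w * (t ^+ N - s ^+ N).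
    by rewrite mulr_ge0 ?(ltW w0)// subr_ge0 lerXn2r ?nnegrE// ltW.
  rewrite -!mulrBr [X in _ <= e * X]ler0_norm; last by rewrite -oppr_ge0 -mulrN opprB.
  by rewrite ler_norml -!mulrN opprB; lra.
have /andP[L1 L2] := @ball_mass_increment t s (g t - e) (g t + e) t0 (ltW ts) sr
    (fun x (xs : t <= x <= s) => gb x ltac:(by move: sd; rewrite !ger0_norm; lra)).
have Kp : 0 <= w * (s ^+ N - t ^+ N).
  by rewrite mulr_ge0 ?(ltW w0)// subr_ge0 lerXn2r ?nnegrE// ltW.
rewrite -!mulrBr [X in _ <= e * X]ger0_norm//.
by rewrite ler_norml; lra.
Qed.

End ball_mass_derivative.

(** * From the distributional equation to the radial one *)

Section assembly.
Context {R : realType}.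

(** The absolute value makes the power continuous at 0 from both sides, since
    [powR] is 1 on negative numbers. *)
Lemma normr_powR_continuous (g : R) : 0 < g -> continuous (fun x : R => `|x| `^ g).
Proof.
move=> g0 x; have [->|x0] := eqVneq x 0.
  apply/cvgrPdist_le => e e0; rewrite normr0 powR0 ?gt_eqF//.
  have [d d0 H] := powR_cvg_at0 g0 e0.
  exists d => //= y; rewrite /ball_/= !sub0r !normrN => yd.
  by rewrite ger0_norm ?powR_ge0//; apply: H => //; exact: ltW.
apply: (@continuous_comp _ _ _ (@Num.norm _ R) (fun y => y `^ g)).
  exact: norm_continuous.
apply/differentiable_continuous/derivable1_diffP.
by apply: derivable_powR; rewrite in_itv/= andbT normr_gt0.
Qed.

Lemma within_cont_powR (g r : R) (V : R -> R) : 0 < g ->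
  {within `[0, r], continuous V} -> (forall t, 0 <= t <= r -> 0 <= V t) ->
  {within `[0, r], continuous (fun t => V t `^ g)}.
Proof.
move=> g0 cV V0; apply/subspace_continuousP => t tr.
have Vt : 0 <= V t by apply: V0; move: tr; rewrite /= in_itv.
have /subspace_continuousP/(_ _ tr) c := cV.
have c2 : `|V s| `^ g @[s --> within `[0, r] (nbhs t)] --> `|V t| `^ g.
  exact: (cvg_comp V (fun y => `|y| `^ g) c (normr_powR_continuous g0 (x := V t))).
rewrite (ger0_norm Vt) in c2.
apply: cvg_trans c2; apply: near_eq_cvg.
rewrite near_withinE; near=> s => sr.
by rewrite ger0_norm//; apply: V0; move: sr; rewrite /= in_itv.
Unshelve. all: by end_near. Qed.

Lemma pq_power_inverse_lipschitz (p q : R) : 1 < p -> p <= q -> q <= 2 ->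
  inverse_lipschitz (pq_power p q).
Proof.
move=> p1 pq q2 M.
have M1 : 0 < Num.max M 1 by rewrite lt_max ltr01 orbT.
have MM : M <= Num.max M 1 by rewrite le_max lexx.
have p01 : 0 < p - 1 <= 1 by lra.
have L0 : 0 < ((p - 1) * Num.max M 1 `^ (p - 1 - 1))^-1.
  by rewrite invr_gt0 mulr_gt0 ?powR_gt0//; case/andP: p01.
exists ((p - 1) * Num.max M 1 `^ (p - 1 - 1))^-1 => // s t s0 st tM.
apply: le_trans (powR_inv_lipschitz p01 M1 s0 st (le_trans tM MM)) _.
rewrite ler_wpM2l ?(ltW L0)// /pq_power.
have q0 : 0 <= q - 1 by lra.
have : s `^ (q - 1) <= t `^ (q - 1).
  by apply: (ge0_ler_powR q0) => //; rewrite ?nnegrE// (le_trans s0).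
lra.
Qed.

Variables (n : nat) (p q c delta alpha r : R) (h u : 'rV[R]_n.+1 -> R).
Local Notation N := n.+1.
Local Notation mu := (@lebesgue_rV R N).
Hypotheses (p_gt1 : 1 < p) (p_le_q : p <= q).
Hypotheses (delta_gt0 : 0 < delta) (c_gt0 : 0 < c) (r_gt0 : 0 < r).
Hypothesis alpha_gt0 : 0 < alpha.
Hypothesis h_cont : {within eball r, continuous h}.
Hypothesis h_radial : radial (eball r) h.
Hypothesis h_ge0 : forall x, eball r x -> 0 <= h x.
Hypothesis u_C1 : C1_holder alpha r u.
Hypothesis u_decr : radially_decreasing (ecball r) u.
Hypothesis u_sol : weak_solution p q c delta r h u.

Lemma continuous_axis : continuous (@axis R n).
Proof. by move=> t; apply: cvgZr_tmp; exact: cvg_id. Qed.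

Lemma radial_datum_continuous (t : R) : `|t| < r ->
  h (axis s) @[s --> t] --> h (axis t).
Proof.
move=> tr; have xr : eball r (axis t : 'rV[R]_N) := eball_axis tr.
have ch : {for (axis t : 'rV[R]_N), continuous h}.
  have := h_cont; rewrite continuous_open_subspace; last exact: open_eball.
  by apply; rewrite inE.
exact: (continuous_comp (@continuous_axis t) ch).
Qed.

Let u_gt0 x : eball r x -> 0 < u x.
Proof. by case: u_sol => ub ui _; exact: (solution_gt0 c_gt0 delta_gt0 r_gt0 u_decr ub ui). Qed.

Let f x := c * u x `^ (- delta) + h x.
Let g (t : R) := f (axis t).

Let q_gt1 : 1 < q. Proof. exact: lt_le_trans p_le_q. Qed.

Let sourceE x : eball r x -> source c delta h u x = (f x)%:E.
Proof. by move=> xr; rewrite source_fin// u_gt0. Qed.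

Let f_ge0 x : eball r x -> 0 <= f x.
Proof. by move=> xr; rewrite addr_ge0 ?h_ge0// mulr_ge0 ?powR_ge0// ltW. Qed.

Let f_int (t : R) : 0 < t < r -> mu.-integrable (ecball t) (EFin \o f).
Proof.
move=> /andP[t0 tr]; have sub : ecball t `<=` (eball r : set 'rV[R]_N).
  by move=> x xt; exact: le_lt_trans xt tr.
case: u_sol => _ ui _; have := ui _ (@compact_ecball R N t) sub.
apply: eq_integrable; first exact: measurable_ecball.
by move=> x; rewrite inE => /sub xr; rewrite sourceE.
Qed.

Let fg x : eball r x -> f x = g (enorm x).
Proof.
move=> xr; have ar : eball r (axis (enorm x) : 'rV[R]_N).
  by apply: eball_axis; rewrite ger0_norm ?enorm_ge0.
have E : enorm x = enorm (axis (enorm x) : 'rV[R]_N).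
  by rewrite enorm_axis ger0_norm ?enorm_ge0.
rewrite /g /f; congr (_ * _ `^ _ + _).
  by apply: (proj1 u_decr) => //; exact: ltW.
exact: h_radial.
Qed.

(** All that the rest of the proof retains of a solution. The normal derivative
    is the limit of the slope at the boundary, by the mean value theorem. *)
Lemma radial_solution : exists V, radial_profile n (pq_power p q) c delta r
    (fun t => h (axis t)) (fun t => u (axis t)) V /\
  forall x, esphere r x -> is_normal_derivative r u x (- V r).
Proof.
have [uc ud [G GE [C HC]]] := u_C1.
case: (u_sol) => ub ui uw.
pose V := radial_slope G.
have rr := r_gt0.
have Vc : {within `[0, r], continuous V} := radial_slope_cont alpha_gt0 HC.
have V0 (t : R) : 0 <= t <= r -> 0 <= V t.
  exact: (radial_slope_ge0 alpha_gt0 r_gt0 ud u_decr GE HC).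
have Vz : V 0 = 0 by exact: (radial_slope0 r_gt0 ud u_decr GE).
have dU (t : R) : `|t| < r -> is_derive t 1 (fun t => u (axis t)) (- V t).
  exact: (radial_profile_deriv ud GE).
have cU : {within `[0, r], continuous (fun t => u (axis t))}.
  exact: radial_profile_cont.
have Ac : {within `[0, r], continuous (fun t => pq_power p q (V t))}.
  have cp : {within `[0, r], continuous (fun t => V t `^ (p - 1))}.
    by apply: within_cont_powR => //; rewrite subr_gt0.
  have cq : {within `[0, r], continuous (fun t => V t `^ (q - 1))}.
    by apply: within_cont_powR => //; rewrite subr_gt0.
  apply/subspace_continuousP => t tr; apply: cvgD.
    by move/subspace_continuousP : cp => /(_ _ tr).
  by move/subspace_continuousP : cq => /(_ _ tr).
have weak (a b : R) : 0 < a -> a < b -> b < r ^+ 2 ->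
  (\int[mu]_(x in eball r)
     (2 * cutoff_slope a b (dotp x x) * (enorm x * pq_power p q (V (enorm x))))%:E =
   \int[mu]_(x in eball r) (f x * cutoff a b (dotp x x))%:E)%E.
  move=> a0 ab br; have b0 : 0 <= b by rewrite ltW// (lt_trans a0).
  have := uw _ (@test_function_cutoff R a b ab N r b0 r_gt0 br).
  under [X in X = _ -> _]eq_integral => x.
    rewrite inE => xr; rewrite (grad_cutoff ab) dotpZr dotpDl.
    have -> : - (2 * cutoff_slope a b (dotp x x)) *
      (dotp (flux p (grad u x)) x + dotp (flux q (grad u x)) x) =
      2 * cutoff_slope a b (dotp x x) * (enorm x * pq_power p q (V (enorm x))).
      have [->|x0] := eqVneq x 0.
        have d0 (y : 'rV[R]_N) : dotp y 0 = 0.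
          by rewrite -(scale0r (0 : 'rV[R]_N)) dotpZr mul0r.
        by rewrite !d0 enorm0 mul0r addr0 !mulr0.
      rewrite !(dotp_flux_radial alpha_gt0 r_gt0 ud u_decr GE HC)//.
      by rewrite -/V /pq_power; ring.
    over.
  move=> ->; apply: eq_integral => x; rewrite inE => xr.
  by rewrite sourceE.
have flux_mass := ball_mass_flux Vc f_ge0 f_int weak Ac.
exists V; split.
  split => //.
  - apply/subspace_continuousP => t tr; apply: cvgM.
      by apply: cvg_within_filter; exact: exprn_continuous.
    by move/subspace_continuousP : Ac => /(_ _ tr).
  - by move=> t /andP[t0 tr]; apply: dU; rewrite gtr0_norm.
  - move=> t tr; have /andP[t0 tr'] := tr.
    have tn : `|t| < r by rewrite gtr0_norm.
    have Ut : 0 < u (axis t) by apply: u_gt0; apply: eball_axis.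
    have cg : g s @[s --> t] --> g t.
      apply: cvgD; last exact: radial_datum_continuous.
      apply: cvgMr.
      have D : derivable (fun y : R => y `^ (- delta)) (u (axis t)) 1.
        by apply: derivable_powR; rewrite in_itv/= andbT.
      have cp : {for u (axis t), continuous (fun y : R => y `^ (- delta))}.
        exact/differentiable_continuous/derivable1_diffP.
      apply: (@continuous_comp _ _ _ (fun s : R => u (axis s)) (fun y : R => y `^ (- delta)) t _ cp).
      by apply/differentiable_continuous/derivable1_diffP; case: (dU t tn).
    have w0 : 0 < @unit_ball_volume R N := unit_ball_volume_pos.
    have DH := is_derive_ball_mass f_int fg tr cg.
    have DZ := is_deriveZ (N%:R * @unit_ball_volume R N)^-1 DH.
    apply: (near_eq_is_derive (f := (N%:R * @unit_ball_volume R N)^-1 *: ball_mass f)).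
      have t0r : 0 < Num.min t (r - t) by rewrite lt_min t0 subr_gt0.
      exists (Num.min t (r - t)) => //= s; rewrite /ball_/= distrC lt_min.
      rewrite !ltr_norml => /andP[/andP[s1 s2] /andP[s3 s4]].
      have sr : 0 < s < r by lra.
      have -> : ((N%:R * @unit_ball_volume R N)^-1 *: ball_mass f) s =
        (N%:R * @unit_ball_volume R N)^-1 * ball_mass f s by [].
      rewrite (flux_mass s sr) mulKf//.
      by rewrite mulf_neq0// gt_eqF.
    apply: is_derive_eq DZ _; rewrite /g /f /GRing.scale/=.
    by field; rewrite gt_eqF//= addrC natr1 pnatr_eq0.
  - by rewrite Vz /pq_power !powR0 ?subr_eq0 ?gt_eqF// addr0 mulr0.
  - by apply: ub; rewrite /esphere/= enorm_axis gtr0_norm.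
  - move=> t /andP[t0 tr]; apply: u_gt0; apply: eball_axis.
    by rewrite ger0_norm.
move=> x xr; have {xr}xr : enorm x = r := xr.
have urad y : enorm y <= r -> u y = u (axis (enorm y)).
  move=> yr; apply: (proj1 u_decr) => //.
    by apply: ecball_axis; rewrite ger0_norm ?enorm_ge0.
  by rewrite enorm_axis ger0_norm ?enorm_ge0.
apply/cvgrPdist_le => e e0.
have rin : r \in `[0, r] by rewrite in_itv/= lexx ltW.
have Vr1 : V r < V r + e by lra.
have [d1 d10 H1] := within_cont_lt Vc rin Vr1.
have NVc : {within `[0, r], continuous (fun t => 0 - V t)}.
  by apply: within_cont_B Vc; apply: continuous_subspaceT => t; exact: cvg_cst.
have Vr2 : 0 - V r < 0 - V r + e by lra.
have [d2 d20 H2] := within_cont_lt NVc rin Vr2.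
pose d := Num.min r (Num.min d1 d2).
have d0 : 0 < d by rewrite !lt_min r_gt0 d10.
exists d => // t; rewrite /ball_/= sub0r normrN => td t0.
have [tr td1 td2] : [/\ - t < r, - t < d1 & - t < d2].
  by move: td; rewrite ltr0_norm// !lt_min => /and3P.
have E : x + t *: (r^-1 *: x) = ((r + t) / r) *: x.
  by rewrite scalerA -{1}(scale1r x) -scalerDl; congr (_ *: _); field; rewrite gt_eqF.
have ex : enorm (x + t *: (r^-1 *: x)) = r + t.
  have rt0 : 0 <= r + t by lra.
  by rewrite E enormZ xr ger0_norm ?divr_ge0 ?(ltW r_gt0)// divfK// gt_eqF.
rewrite urad; last by rewrite ex; lra.
rewrite ex (urad x) ?xr//.
have rt : r + t < r by lra.
have rt0 : 0 <= r + t by lra.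
have [|z /andP[z1 z2] Ez] := mvt_exists rt (within_cont_sub cU rt0 (lexx r)) (df := fun z => - V z).
  move=> z /andP[z1 z2]; apply: dU; rewrite gtr0_norm//; lra.
have zin : z \in `[0, r] by rewrite in_itv/=; lra.
have L1 := H1 z zin; have L2 := H2 z zin.
have zr1 : `|z - r| < d1 by rewrite ltr0_norm; lra.
have zr2 : `|z - r| < d2 by rewrite ltr0_norm; lra.
have {}L1 := L1 zr1; have {}L2 := L2 zr2.
have -> : t^-1 * (u (axis (r + t)) - u (axis r)) = - V z.
  have -> : u (axis (r + t)) - u (axis r) = - V z * t by lra.
  by rewrite mulrCA mulVf ?mulr1// lt_eqF.
by rewrite ler_norml; lra.
Qed.

End assembly.

(** * The comparison theorem *)

(** Used to carry [h1 = h2] from the punctured ball to its centre. *)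
Lemma within_continuous_eq0 (R : realType) (k : R -> R) (r : R) : 0 < r ->
  k s @[s --> 0] --> k 0 -> (forall s, 0 < s < r -> k s = 0) -> k 0 = 0.
Proof.
move=> r0 ck k0; apply/eqP; apply: contraT => kn.
have kp : 0 < `|k 0| by rewrite normr_gt0.
move/cvgrPdist_lt : ck => /(_ _ kp) [d /= d0 Hd].
pose s := Num.min (d / 2) (r / 2).
have s0 : 0 < s by rewrite lt_min !divr_gt0.
have sd : s <= d / 2 by rewrite ge_min lexx.
have sr : s <= r / 2 by rewrite ge_min lexx orbT.
have sb : `|0 - s| < d by rewrite sub0r normrN gtr0_norm//; lra.
have ks : k s = 0 by apply: k0; lra.
by have := Hd s sb; rewrite /= ks subr0 ltxx.
Qed.

Theorem theorem1p5 (R : realType) (N : nat) (p q delta c r alpha : R)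
    (h1 h2 u1 u2 : 'rV[R]_N -> R)
    (N_gt0 : (0 < N)%N)
    (p_gt1 : 1 < p) (p_le_q : p <= q) (q_le2 : q <= 2)
    (delta_gt0 : 0 < delta) (delta_lt1 : delta < 1)
    (c_gt0 : 0 < c) (r_gt0 : 0 < r)
    (alpha_gt0 : 0 < alpha) (alpha_lt1 : alpha < 1)
    (h1_cont : {within eball r, continuous h1})
    (h2_cont : {within eball r, continuous h2})
    (h1_radial : radial (eball r) h1) (h2_radial : radial (eball r) h2)
    (h1_ge0 : forall x, eball r x -> 0 <= h1 x)
    (h1_le_h2 : forall x, eball r x -> h1 x <= h2 x)
    (h1_neq_h2 : ~ (forall x, eball r x -> h1 x = h2 x))
    (u1_C1 : C1_holder alpha r u1) (u2_C1 : C1_holder alpha r u2)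
    (u1_decr : radially_decreasing (ecball r) u1)
    (u2_decr : radially_decreasing (ecball r) u2)
    (u1_sol : weak_solution p q c delta r h1 u1)
    (u2_sol : weak_solution p q c delta r h2 u2) :
  (forall x, eball r x -> 0 < u1 x /\ u1 x < u2 x) /\
  (forall x, esphere r x -> exists d1 d2 : R,
     [/\ is_normal_derivative r u1 x d1, is_normal_derivative r u2 x d2,
         d2 < d1 & d1 < 0]).
Proof.
case: N N_gt0 h1 h2 u1 u2 h1_cont h2_cont h1_radial h2_radial h1_ge0 h1_le_h2
  h1_neq_h2 u1_C1 u2_C1 u1_decr u2_decr u1_sol u2_sol => // n _ h1 h2 u1 u2
  h1_cont h2_cont h1_radial h2_radial h1_ge0 h1_le_h2
  h1_neq_h2 u1_C1 u2_C1 u1_decr u2_decr u1_sol u2_sol.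
have h2_ge0 x : eball r x -> 0 <= h2 x.
  by move=> xr; apply: le_trans (h1_ge0 x xr) (h1_le_h2 x xr).
have [V1 [P1 D1]] := radial_solution p_gt1 p_le_q delta_gt0 c_gt0 r_gt0 alpha_gt0
  h1_cont h1_radial h1_ge0 u1_C1 u1_decr u1_sol.
have [V2 [P2 D2]] := radial_solution p_gt1 p_le_q delta_gt0 c_gt0 r_gt0 alpha_gt0
  h2_cont h2_radial h2_ge0 u2_C1 u2_decr u2_sol.
have ball (t : R) : 0 < t < r -> eball r (axis t : 'rV[R]_n.+1).
  by move=> /andP[t0 tr]; apply: eball_axis; rewrite gtr0_norm.
have neq : ~ forall t, 0 < t < r -> h1 (axis t) = h2 (axis t).
  move=> E; apply: h1_neq_h2 => x xr.
  have ar : eball r (axis (enorm x) : 'rV[R]_n.+1).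
    by apply: eball_axis; rewrite ger0_norm ?enorm_ge0.
  have ae : enorm x = enorm (axis (enorm x) : 'rV[R]_n.+1).
    by rewrite enorm_axis ger0_norm ?enorm_ge0.
  rewrite (h1_radial _ _ xr ar ae) (h2_radial _ _ xr ar ae).
  have [x0|x0] := eqVneq (enorm x) 0; last first.
    by apply: E; rewrite lt_neqAle eq_sym x0 enorm_ge0.
  have r0 : `|0 : R| < r by rewrite normr0.
  have c0 := cvgB (radial_datum_continuous h1_cont r0) (radial_datum_continuous h2_cont r0).
  rewrite x0; apply/eqP; rewrite -subr_eq0; apply/eqP.
  apply: (@within_continuous_eq0 _ (fun s => h1 (axis s) - h2 (axis s)) r) => //.
    exact: c0.
  by move=> s sr; rewrite E// subrr.
have A0 : pq_power p q 0 = 0.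
  by rewrite /pq_power !powR0 ?addr0// gt_eqF// subr_gt0// (lt_le_trans p_gt1).
have [U12 /andP[V1r V12]] := radial_strong_comparison
  (pq_power_inverse_lipschitz p_gt1 p_le_q q_le2) A0 c_gt0 delta_gt0 delta_lt1
  r_gt0 P1 P2 (fun t tr => h1_ge0 _ (ball t tr)) (fun t tr => h1_le_h2 _ (ball t tr)) neq.
split=> [x xr|x xr]; last first.
  exists (- V1 r), (- V2 r); split; [exact: D1|exact: D2|by rewrite ltrN2|].
  by rewrite oppr_lt0.
have xr' : ecball r x by exact: ltW.
have ar : ecball r (axis (enorm x) : 'rV[R]_n.+1).
  by apply: ecball_axis; rewrite ger0_norm ?enorm_ge0.
have ae : enorm x = enorm (axis (enorm x) : 'rV[R]_n.+1).
  by rewrite enorm_axis ger0_norm ?enorm_ge0.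
have ex : 0 <= enorm x < r by rewrite enorm_ge0.
rewrite (proj1 u1_decr _ _ xr' ar ae) (proj1 u2_decr _ _ xr' ar ae).
by split; [exact: (profile_gt0 P1)|exact: U12].
Qed.
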